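(* Let $Q$ be a finitely generated abelian group and let $B$ be a finitely generated right $\mathbb{Z}Q$-module of Krull dimension $1$ such that $C_Q(B)=\{q\in Q\mid B(q-1)=0\}=1$. Then $G=B\rtimes Q$ is a transitive self-similar group.
   Context: In $B\rtimes Q$ the group $Q$ acts on $B$ (by conjugation, on the right) via the $\mathbb{Z}Q$-module structure. The Krull dimension of a finitely generated module $B$ over the commutative Noetherian ring $\mathbb{Z}Q$ is the Krull dimension of $\mathbb{Z}Q/\mathrm{ann}_{\mathbb{Z}Q}(B)$. For an integer $k\ge 1$, $\mathcal{T}_k$ is the infinite regular one-rooted $k$-tree (every vertex has exactly $k$ descendants on the next level) and $\mathrm{Aut}(\mathcal{T}_k)$ is its group of level-preserving automorphisms. The first level is identified with $\{0,\ldots,k-1\}$, and every $g\in \mathrm{Aut}(\mathcal{T}_k)$ is written uniquely as $g=(g_0,\ldots,g_{k-1})\sigma$, where $\sigma$ is the permutation of the first level induced by $g$ and $g_i\in\mathrm{Aut}(\mathcal{T}_k)$ is the induced action on the subtree headed by the vertex $i$ (identified with $\mathcal{T}_k$). A subgroup $G\le\mathrm{Aut}(\mathcal{T}_k)$ is state-closed if $g_i\in G$ for all $g\in G$ and all $i$. A group is transitive self-similar if, for some $k$, it is isomorphic to a state-closed subgroup of $\mathrm{Aut}(\mathcal{T}_k)$ acting transitively on the first level of $\mathcal{T}_k$. *)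

(* Defs.v *)
From HB Require Import structures.
From mathcomp Require Import all_boot all_order all_algebra.
From mathcomp Require Import generic_quotient ring_quotient boolp finmap.
From mathcomp.multinomials Require Import monalg.

Set Implicit Arguments.
Unset Strict Implicit.
Unset Printing Implicit Defensive.

Import GRing.Theory.
Local Open Scope ring_scope.

(* Subsets are collective boolean predicates; the classical axioms of boolp   *)
(* turn every Prop-valued predicate into one.                                 *)

Section GroupRing.
Variable Q : zmodType.

(* The integral group ring of an abelian group written additively, as the     *)
(* finitely supported functions Q -> int. monalg puts a product on            *)
(* {malg int[M]} only for monoids M without nontrivial units, hence the       *)
(* convolution below. << q >> is the element of ZQ given by q : Q, so that    *)
(* << p + q >> = << p >> * << q >> and << 0 >> = 1.                           *)
Definition groupring : Type := {malg int[Q]}.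

Implicit Types (g : {malg int[Q]}) (k : Q).

Definition grone : {malg int[Q]} := << 0 : Q >>.

Definition grmul g1 g2 : {malg int[Q]} :=
  \sum_(k1 <- msupp g1) \sum_(k2 <- msupp g2)
    << g1@_k1 * g2@_k2 *g k1 + k2 >>.

Lemma grmulw (d1 d2 : {fset Q}) g1 g2 :
  (msupp g1 `<=` d1)%fset -> (msupp g2 `<=` d2)%fset ->
  grmul g1 g2 =
    \sum_(k1 <- d1) \sum_(k2 <- d2) << g1@_k1 * g2@_k2 *g k1 + k2 >>.
Proof.
move=> le_d1 le_d2; rewrite /grmul (big_fset_incl _ le_d1) /=.
  apply/eq_bigr=> k1 _; apply/big_fset_incl => // k _ /mcoeff_outdom ->.
  by rewrite mulr0 monalgU0.
move=> k _ /mcoeff_outdom g1k.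
by rewrite big1 => // k' _; rewrite g1k mul0r monalgU0.
Qed.

Lemma grmulC : commutative grmul.
Proof.
move=> g1 g2; rewrite /grmul exchange_big; apply: eq_bigr => k1 _.
by apply: eq_bigr => k2 _; rewrite mulrC addrC.
Qed.

Lemma grmul0g : left_zero 0 grmul.
Proof. by move=> g; rewrite /grmul msupp0 big_seq_fset0. Qed.

Lemma grmulUU (c1 c2 : int) k1 k2 :
  grmul << c1 *g k1 >> << c2 *g k2 >> = << c1 * c2 *g k1 + k2 >>.
Proof. by rewrite (grmulw msuppU_le msuppU_le) !big_seq_fset1 !mcoeffUU. Qed.

Lemma grmul1g : left_id grone grmul.
Proof.
move=> g; rewrite (grmulw msuppU_le (fsubset_refl _)) big_seq_fset1.
rewrite [RHS]monalgE; apply/eq_bigr=> k _.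
by rewrite mcoeffUU mul1r add0r.
Qed.

Lemma grmulDl : left_distributive grmul +%R.
Proof.
move=> g1 g2 g.
rewrite [in RHS](grmulw (fsubsetUl _ (msupp g2)) (fsubset_refl _)).
rewrite [in RHS](grmulw (fsubsetUr (msupp g1) _) (fsubset_refl _)).
rewrite (grmulw (msuppD_le _ _) (fsubset_refl _)).
rewrite -big_split /=; apply/eq_bigr=> k1 _.
rewrite -big_split /=; apply/eq_bigr=> k2 _.
by rewrite mcoeffD mulrDl monalgUD.
Qed.

Lemma grmulA : associative grmul.
Proof.
have suml I (r : seq I) F g :
    grmul (\sum_(i <- r) F i) g = \sum_(i <- r) grmul (F i) g.
  exact: (big_morph (grmul^~ g) (fun x y => grmulDl x y g) (grmul0g g)).
have sumr I (r : seq I) F g :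
    grmul g (\sum_(i <- r) F i) = \sum_(i <- r) grmul g (F i).
  by rewrite grmulC suml; apply: eq_bigr => i _; rewrite grmulC.
have UU := grmulUU; move: suml sumr UU; generalize grmul => m suml sumr UU.
move=> g1 g2 g3; rewrite (monalgE g1) (monalgE g2) (monalgE g3).
rewrite !suml; apply: eq_bigr => k1 _.
rewrite [LHS]sumr [in RHS](sumr _ (msupp g2)) suml; apply: eq_bigr => k2 _.
rewrite !sumr; apply: eq_bigr => k3 _.
by rewrite !UU mulrA addrA.
Qed.

Lemma grone_neq0 : grone != 0.
Proof. by rewrite monalgU_eq0. Qed.

HB.instance Definition _ := GRing.Zmodule.on groupring.
HB.instance Definition _ := GRing.Zmodule_isComNzRing.Build groupring
  grmulA grmulC grmul1g grmulDl grone_neq0.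

Definition gr (q : Q) : groupring := << q >>.

Lemma grD : {morph gr : p q / p + q >-> p * q}.
Proof. by move=> p q; rewrite /gr [RHS]grmulUU mulr1. Qed.

Lemma gr0 : gr 0 = 1.
Proof. by []. Qed.

End GroupRing.

Definition fg_group (Q : zmodType) : Prop :=
  exists (n : nat) (s : 'I_n -> Q),
    forall q, exists c : 'I_n -> int, q = \sum_(i < n) s i *~ c i.

Definition fg_module (R : comPzRingType) (V : lmodType R) : Prop :=
  exists (n : nat) (s : 'I_n -> V),
    forall v, exists c : 'I_n -> R, v = \sum_(i < n) c i *: s i.

(* The ideal predicates of ring_quotient are confined to nonzero rings; here  *)
(* the zero ring is allowed, since it is the quotient by the annihilator of   *)
(* the zero module.                                                           *)
Definition prime_ideal (R : comPzRingType) (P : {pred R}) : Prop :=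
  [/\ 0 \in P, 1 \notin P,
      forall a x y, x \in P -> y \in P -> a * x + y \in P
    & forall x y, x * y \in P -> (x \in P) || (y \in P)].

Definition prime_chain (R : comPzRingType) (n : nat) : Prop :=
  exists P : nat -> {pred R},
    (forall i, (i <= n)%N -> prime_ideal (P i)) /\
    (forall i, (i < n)%N ->
       {subset P i <= P i.+1} /\ ~ {subset P i.+1 <= P i}).

Definition has_krull_dim (R : comPzRingType) (d : nat) : Prop :=
  prime_chain R d /\ forall n, prime_chain R n -> (n <= d)%N.

Section Annihilator.
Variables (R : comPzRingType) (V : lmodType R).

Definition annihilator : {pred R} := [pred a | `[< forall v : V, a *: v = 0 >]].

Lemma annihilatorP a : reflect (forall v : V, a *: v = 0) (a \in annihilator).
Proof. exact: asboolP. Qed.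

Fact annihilator_zmod_closed : zmod_closed annihilator.
Proof.
split=> [|a b /annihilatorP a0 /annihilatorP b0]; apply/annihilatorP=> v.
  by rewrite scale0r.
by rewrite scalerBl a0 b0 subrr.
Qed.
HB.instance Definition _ :=
  GRing.isZmodClosed.Build R annihilator annihilator_zmod_closed.

Lemma annihilatorMl a b : b \in annihilator -> a * b \in annihilator.
Proof.
by move=> /annihilatorP b0; apply/annihilatorP=> v; rewrite -scalerA b0 scaler0.
Qed.

(* R / ann_R(V), with the library's additive structure on the quotient.       *)
Definition ann_quot : Type := Quotient.quot annihilator.
HB.instance Definition _ := GRing.Zmodule.on ann_quot.

Local Notation pi x := (\pi_(Quotient.quot annihilator) x : ann_quot)%qT.

Definition annq_mul (x y : ann_quot) : ann_quot := pi (repr x * repr y).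

Lemma annq_pi_eq a b : (pi a = pi b) <-> a - b \in annihilator.
Proof. by rewrite Quotient.idealrBE; split=> [/eqP|/eqP]. Qed.

Lemma annq_pi_mul a b : annq_mul (pi a) (pi b) = pi (a * b).
Proof.
apply/annq_pi_eq.
have h c : repr (pi c) - c \in annihilator by apply/annq_pi_eq; rewrite reprK.
set a' := repr _; set b' := repr _.
have -> : a' * b' - a * b = a' * (b' - b) + b * (a' - a).
  by rewrite !mulrBr (mulrC b a') (mulrC b a) addrA subrK.
by rewrite rpredD ?annihilatorMl ?h.
Qed.

Lemma annq_pi_surj (x : ann_quot) : x = pi (repr x).
Proof. by rewrite reprK. Qed.

Lemma annq_pi_add a b : pi a + pi b = pi (a + b).
Proof. by rewrite [RHS]Quotient.pi_add. Qed.

Fact annq_mulA : associative annq_mul.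
Proof.
move=> x y z; rewrite (annq_pi_surj x) (annq_pi_surj y) (annq_pi_surj z).
by rewrite !annq_pi_mul mulrA.
Qed.

Fact annq_mulC : commutative annq_mul.
Proof. by move=> x y; rewrite /annq_mul mulrC. Qed.

Fact annq_mul1 : left_id (pi 1) annq_mul.
Proof. by move=> x; rewrite (annq_pi_surj x) annq_pi_mul mul1r. Qed.

Fact annq_mulDl : left_distributive annq_mul +%R.
Proof.
move=> x y z; rewrite (annq_pi_surj x) (annq_pi_surj y) (annq_pi_surj z).
by rewrite annq_pi_add !annq_pi_mul mulrDl annq_pi_add.
Qed.

HB.instance Definition _ := GRing.Zmodule_isComPzRing.Build ann_quot
  annq_mulA annq_mulC annq_mul1 annq_mulDl.

Definition module_has_krull_dim (d : nat) : Prop := has_krull_dim ann_quot d.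

End Annihilator.

(* ZQ is commutative, so a right ZQ-module is a (left) lmodType: the right    *)
(* action b q is written gr q *: b.                                           *)

Definition centralizer (Q : zmodType) (B : lmodType (groupring Q)) : {pred Q} :=
  [pred q | `[< forall b : B, (gr q - 1) *: b = 0 >]].

Section Semidirect.
Variables (Q : zmodType) (B : lmodType (groupring Q)).

(* The pair (b, q) stands for the product q b, so that conjugation by q is    *)
(* the right action of q on B: see sdprod_conj.                               *)
Definition sdprod : Type := (B * Q)%type.
HB.instance Definition _ := Choice.on sdprod.

Definition sdprod_one : sdprod := (0, 0).
Definition sdprod_inv (x : sdprod) : sdprod := (- (gr (- x.2) *: x.1), - x.2).
Definition sdprod_mul (x y : sdprod) : sdprod :=
  (gr y.2 *: x.1 + y.1, x.2 + y.2).

Fact sdprod_mulA : associative sdprod_mul.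
Proof.
case=> [a p] [b q] [c r]; rewrite /sdprod_mul /=; congr pair; last exact: addrA.
by rewrite scalerDr scalerA -grD addrA (addrC q r).
Qed.

Fact sdprod_mul1g : left_id sdprod_one sdprod_mul.
Proof. by case=> [a p]; rewrite /sdprod_mul /= scaler0 !add0r. Qed.

Fact sdprod_mulg1 : right_id sdprod_one sdprod_mul.
Proof. by case=> [a p]; rewrite /sdprod_mul /= gr0 scale1r !addr0. Qed.

Fact sdprod_mulVg : left_inverse sdprod_one sdprod_inv sdprod_mul.
Proof.
case=> [a p]; rewrite /sdprod_mul /= scalerN scalerA -grD subrr gr0 scale1r.
by rewrite !addNr.
Qed.

Fact sdprod_mulgV : right_inverse sdprod_one sdprod_inv sdprod_mul.
Proof. by case=> [a p]; rewrite /sdprod_mul /= !subrr. Qed.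

HB.instance Definition _ := isGroup.Build sdprod
  sdprod_mulA sdprod_mul1g sdprod_mulg1 sdprod_mulVg sdprod_mulgV.

Lemma sdprod_conj (b : B) (q : Q) :
  (((b, 0) : sdprod) ^ ((0, q) : sdprod) = (gr q *: b, 0) :> sdprod)%g.
Proof.
rewrite /conjg [LHS]/(sdprod_mul _ (sdprod_mul _ _)) /sdprod_mul /=.
by rewrite scaler0 oppr0 scaler0 add0r addr0 add0r addNr.
Qed.

End Semidirect.

Section TreeAut.
Variable k : nat.

(* Vertices are words; the descendants of v on the next level are the words   *)
(* rcons v i.                                                                 *)
Definition vertex : Type := seq 'I_k.

Definition descendant (v w : vertex) : Prop := exists i, w = rcons v i.

Definition is_tree_aut (f : vertex -> vertex) : Prop :=
  [/\ bijective f, forall v, size (f v) = size v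
    & forall v w, descendant v w <-> descendant (f v) (f w)].

Record treeAut : Type := TreeAut {
  tree_fun :> vertex -> vertex;
  _ : `[< is_tree_aut tree_fun >]
}.
HB.instance Definition _ := [isSub for tree_fun].
HB.instance Definition _ := [Choice of treeAut by <:].

Lemma tree_autP (g : treeAut) : is_tree_aut g.
Proof. by case: g => f h; apply/asboolP. Qed.

Definition mk_treeAut f (h : is_tree_aut f) : treeAut := TreeAut (asboolT h).

Lemma treeAut_eq (g h : treeAut) : g =1 h -> g = h.
Proof. by move=> gh; apply/val_inj/funext. Qed.

Fact id_is_tree_aut : is_tree_aut id.
Proof. by split=> //; exists id. Qed.

Fact comp_is_tree_aut (g h : treeAut) : is_tree_aut (h \o g).
Proof.
case: (tree_autP g) (tree_autP h) => [gb gs gd] [hb hs hd].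
split=> [|v|v w] /=; first exact: bij_comp.
  by rewrite hs gs.
by rewrite gd hd.
Qed.

Fact tree_inv_subproof (g : treeAut) :
  { f : vertex -> vertex | cancel g f /\ cancel f g }.
Proof. by apply: cid; case: (tree_autP g) => [[f gf fg] _ _]; exists f. Qed.

Definition tree_inv (g : treeAut) : vertex -> vertex :=
  sval (tree_inv_subproof g).

Lemma tree_funK (g : treeAut) : cancel g (tree_inv g).
Proof. by case: (svalP (tree_inv_subproof g)). Qed.

Lemma tree_invK (g : treeAut) : cancel (tree_inv g) g.
Proof. by case: (svalP (tree_inv_subproof g)). Qed.

Fact inv_is_tree_aut (g : treeAut) : is_tree_aut (tree_inv g).
Proof.
case: (tree_autP g) => [_ gs gd]; split=> [|v|v w].
- by exists g; [exact: tree_invK | exact: tree_funK].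
- by rewrite -gs tree_invK.
- by rewrite (gd (tree_inv g v)) !tree_invK.
Qed.

(* Automorphisms act on the right: g * h is g followed by h. *)
Definition treeAut_one : treeAut := mk_treeAut id_is_tree_aut.
Definition treeAut_mul (g h : treeAut) : treeAut :=
  mk_treeAut (comp_is_tree_aut g h).
Definition treeAut_inv (g : treeAut) : treeAut :=
  mk_treeAut (inv_is_tree_aut g).

Fact treeAut_mulA : associative treeAut_mul.
Proof. by move=> f g h; apply: treeAut_eq. Qed.

Fact treeAut_mul1g : left_id treeAut_one treeAut_mul.
Proof. by move=> g; apply: treeAut_eq. Qed.

Fact treeAut_mulg1 : right_id treeAut_one treeAut_mul.
Proof. by move=> g; apply: treeAut_eq. Qed.

Fact treeAut_mulVg : left_inverse treeAut_one treeAut_inv treeAut_mul.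
Proof. by move=> g; apply: treeAut_eq => v /=; rewrite tree_invK. Qed.

Fact treeAut_mulgV : right_inverse treeAut_one treeAut_inv treeAut_mul.
Proof. by move=> g; apply: treeAut_eq => v /=; rewrite tree_funK. Qed.

HB.instance Definition _ := isGroup.Build treeAut
  treeAut_mulA treeAut_mul1g treeAut_mulg1 treeAut_mulVg treeAut_mulgV.

Definition level1_fun (g : treeAut) (i : 'I_k) : 'I_k := head i (g [:: i]).

Definition section_fun (g : treeAut) (i : 'I_k) (w : vertex) : vertex :=
  behead (g (i :: w)).

Lemma level1_sectionE (g : treeAut) (i : 'I_k) (w : vertex) :
  g (i :: w) = level1_fun g i :: section_fun g i w.
Proof.
have [_ gs gd] := tree_autP g.
suff [u] : exists u, g (i :: w) = g [:: i] ++ u.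
  rewrite /section_fun /level1_fun => ->.
  by case: (g [:: i]) (gs [:: i]) => [|a []].
elim/last_ind: w => [|w j [u IHu]]; first by exists [::]; rewrite cats0.
have [|a ->] := (gd (i :: w) (i :: rcons w j)).1; first by exists j.
by exists (rcons u a); rewrite IHu rcons_cat.
Qed.

Fact section_is_tree_aut (g : treeAut) (i : 'I_k) :
  is_tree_aut (section_fun g i).
Proof.
have [_ gs gd] := tree_autP g.
have consD (a : 'I_k) v w : descendant (a :: v) (a :: w) <-> descendant v w.
  by split=> -[b]; [case=> -> | move->]; exists b.
split=> [|v|v w].
- pose j := level1_fun g i.
  have gi w : treeAut_inv g (j :: w) = i :: section_fun (treeAut_inv g) j w.
    rewrite level1_sectionE; congr cons.
    have := tree_funK g [:: i]; rewrite level1_sectionE -/j /=.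
    rewrite -[tree_inv g]/(treeAut_inv g : vertex -> vertex) level1_sectionE.
    by case.
  exists (section_fun (treeAut_inv g) j) => w.
    rewrite /section_fun [in X in treeAut_inv g X](_ : j :: _ = g (i :: w)) /=.
      by rewrite tree_funK.
    by rewrite level1_sectionE.
  by rewrite /section_fun -/(section_fun (treeAut_inv g) j w) -gi /= tree_invK.
- by have := gs (i :: v); rewrite level1_sectionE => -[].
- by rewrite -(consD i) gd !level1_sectionE consD.
Qed.

(* g = (tree_section g 0, ..., tree_section g (k - 1)) sigma, with sigma the  *)
(* permutation level1_fun g: see level1_sectionE.                             *)
Definition tree_section (g : treeAut) (i : 'I_k) : treeAut :=
  mk_treeAut (section_is_tree_aut g i).

Definition state_closed (H : {pred treeAut}) : Prop :=
  forall g, g \in H -> forall i, tree_section g i \in H.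

Definition level1_transitive (H : {pred treeAut}) : Prop :=
  forall i j : 'I_k, exists2 g, g \in H & g [:: i] = [:: j].

End TreeAut.

Definition isomorphic_onto (G A : groupType) (H : {pred A}) : Prop :=
  exists phi : G -> A,
    [/\ {morph phi : x y / (x * y)%g}, injective phi
      & forall a, a \in H <-> exists x, phi x = a].

Definition transitive_self_similar (G : groupType) : Prop :=
  exists (k : nat) (H : {pred treeAut k}),
    [/\ (1 <= k)%N, group_closed H, state_closed H, level1_transitive H
      & isomorphic_onto G H].

(* Main.v *)
From HB Require Import structures.
Require Import Defs.
From mathcomp Require Import all_boot all_order all_algebra ring.
From mathcomp Require Import generic_quotient ring_quotient boolp finmap.
From mathcomp.multinomials Require Import monalg.

(** Let R = ZQ. A group is transitive self-similar as soon as it has a virtual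
    endomorphism f : H -> G (H of finite index) that is simple: no nontrivial
    normal subgroup K of G satisfies K <= H and f(K) <= K. Indeed G then acts
    on the right cosets of H, the state of g at a coset is the image by f of
    the Schreier cocycle, and the kernel of the resulting action on the tree
    is an f-invariant normal subgroup (self_similar_of_transversal).

    For G = B >| Q the endomorphism divides by an element a of R. Suppose that
    B/aB is finite and that the intersection of the a^k B is 0. The kernels of
    the a^n on B are eventually constant, so for n large a is injective on
    M = a^n B; take H = aM >| Q and f(a m, q) = (m, q). If K is as above, every
    element of K in B is divisible by all powers of a, hence is trivial, and
    then K centralizes B, so that K = 1 because C_Q(B) = 1
    (sdprod_self_similar).

    The element a comes from a filtration 0 = V_0 < ... < V_s = B with
    V_i = V_{i-1} + R x_i and with all the colon ideals
    P_i = (V_{i-1} : x_i) prime; it exists because R is Noetherian. Choose a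
    maximal ideal m_i above each P_i, and by prime avoidance an a that belongs
    to every m_i and to no nonmaximal P_i.
    - If v is divisible by all powers of a, a Krull intersection argument
      yields r with (1 - r a) v = 0. If v <> 0, then 1 - r a lies in some
      P_i, hence in m_i, which contains a: a contradiction.
    - The quotient B/aB is filtered by quotients of the R/(P_i + aR), and
      these are finite. In dimension 1 every prime ideal above P_i + aR is
      maximal; an ideal with that property has finite index, because one of
      infinite index and maximal as such would be prime
      (finite_quotient_of_primes) while the residue fields of R are finite.

    Finiteness of residue fields is Zariski's lemma over Z (zariski_lemma,
    finite_field_of_generates). *)

Set Implicit Arguments.
Unset Strict Implicit.
Unset Printing Implicit Defensive.

Import Order.TTheory GRing.Theory Num.Theory.
Local Open Scope ring_scope.

(** * Ascending chain conditions *)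

(** The class C of subsets is left abstract in order to treat ideals and
    submodules alike; chains avoid any mention of generators, and make the
    proofs below simple comparisons of ranks of stabilization. *)
Definition acc (T : Type) (C : (T -> Prop) -> Prop) : Prop :=
  forall N : nat -> T -> Prop,
    (forall i, C (N i)) -> (forall i x, N i x -> N i.+1 x) ->
  exists n, forall m x, N m x -> N n x.

Lemma chain_le (T : Type) (N : nat -> T -> Prop) :
    (forall i x, N i x -> N i.+1 x) ->
  forall i j x, (i <= j)%N -> N i x -> N j x.
Proof.
move=> Ninc i j x /subnK <- Nx; elim: (j - i)%N => // d IHd.
by rewrite addSn; apply: Ninc.
Qed.

(** Without a maximal element, a choice of strictly larger members of F would
    produce a chain that never stabilizes. *)
Lemma acc_maximal (T : Type) (C F : (T -> Prop) -> Prop) (N0 : T -> Prop) :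
    acc C -> (forall N, F N -> C N) -> F N0 ->
  exists2 N, F N & forall N', F N' -> (forall x, N x -> N' x) ->
    forall x, N' x -> N x.
Proof.
move=> accC FC FN0; apply: contrapT => noMax.
have step (N : {N | F N}) : exists N' : {N | F N},
    (forall x, sval N x -> sval N' x) /\ exists x, sval N' x /\ ~ sval N x.
  apply: contrapT => noN; apply: noMax; exists (sval N); first exact: svalP.
  move=> N' FN' NN' x N'x; apply: contrapT => Nx.
  by apply: noN; exists (exist _ N' FN'); split=> //; exists x.
have [next nextP] := choice step.
pose c i := iter i next (exist _ N0 FN0).
have [i|i x|n nP] := accC (fun i => sval (c i)).
- exact/FC/(svalP (c i)).
- exact: (nextP (c i)).1.
- have [_ [x [cx ncx]]] := nextP (c n).
  exact/ncx/(nP n.+1).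
Qed.

Section Submodules.
Variables (R : comNzRingType) (V : lmodType R).
Implicit Types N : V -> Prop.

Definition submodule N : Prop :=
  N 0 /\ forall (a : R) (x y : V), N x -> N y -> N (a *: x + y).

Variable N : V -> Prop.
Hypothesis Nsub : submodule N.

Lemma submoduleD x y : N x -> N y -> N (x + y).
Proof. by move=> Nx Ny; have := Nsub.2 1 x y Nx Ny; rewrite scale1r. Qed.
Lemma submoduleZ a x : N x -> N (a *: x).
Proof. by move=> Nx; have := Nsub.2 a x 0 Nx Nsub.1; rewrite addr0. Qed.
Lemma submoduleB x y : N x -> N y -> N (x - y).
Proof. by move=> Nx Ny; rewrite addrC -scaleN1r; apply: Nsub.2. Qed.

End Submodules.

Definition ideal (R : comNzRingType) (I : R -> Prop) : Prop :=
  I 0 /\ forall a x y, I x -> I y -> I (a * x + y).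

Section Ideals.
Variables (R : comNzRingType) (I : R -> Prop).
Hypothesis Iid : ideal I.
Lemma ideal_add x y : I x -> I y -> I (x + y).
Proof. exact: (@submoduleD R R^o I Iid). Qed.
Lemma ideal_mull a x : I x -> I (a * x).
Proof. exact: (@submoduleZ R R^o I Iid). Qed.
Lemma ideal_mulr a x : I x -> I (x * a).
Proof. by rewrite mulrC; apply: ideal_mull. Qed.
Lemma ideal_sub x y : I x -> I y -> I (x - y).
Proof. exact: (@submoduleB R R^o I Iid). Qed.
End Ideals.

Definition noetherian (R : comNzRingType) : Prop := acc (@ideal R).

Lemma noetherian_image (R S : comNzRingType) (f : {rmorphism R -> S}) :
  (forall y, exists x, f x = y) -> noetherian R -> noetherian S.
Proof.
move=> fsurj accR N Nid Ninc.
have [i|i x|n nP] := accR (fun i x => N i (f x)).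
- have [N0 NS] := Nid i; split=> [|a x y Nx Ny]; first by rewrite rmorph0.
  by rewrite rmorphD rmorphM; apply: NS.
- exact: Ninc.
by exists n => m y; have [x <-] := fsurj y; apply: nP.
Qed.

(** Hilbert's basis theorem. For a chain of ideals N k of R[X], the ideals
    lead k d of coefficients in degree d of the members of N k of degree at most
    d increase with k and with d. Stabilization of the diagonal lead i i settles
    all large d at once, and the finitely many remaining columns stabilize one
    by one; two nested ideals with the same leading coefficients are equal. *)
Lemma noetherian_poly (R : comNzRingType) :
  noetherian R -> noetherian {poly R}.
Proof.
move=> accR N Nid Ninc.
have Nle := chain_le Ninc.
pose lead k d c := exists2 p, N k p & (size p <= d.+1)%N /\ p`_d = c.
have lead_ideal k d : ideal (lead k d).
  have [N0 NS] := Nid k; split.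
    by exists 0; rewrite ?size_poly0 ?coef0.
  move=> a _ _ [p Np [sp <-]] [q Nq [sq <-]]; exists (a%:P * p + q).
    exact: NS.
  rewrite coefD coefCM mul_polyC; split=> //.
  rewrite (leq_trans (size_polyD _ _)) // geq_max sq.
  by rewrite (leq_trans (size_scale_leq _ _)).
have lead_le k k' d d' c :
    (k <= k')%N -> (d <= d')%N -> lead k d c -> lead k' d' c.
  move=> lek /subnKC <- [p Np [sp <-]]; exists ('X^(d' - d) * p).
    by apply: ideal_mull; [exact: Nid | exact: Nle Np].
  rewrite coefXnM ltnNge leq_addl /= addnK; split=> //.
  have [->|p0] := eqVneq p 0; first by rewrite mulr0 size_poly0.
  by rewrite mulrC size_mulXn // addnC -addSn leq_add2r.
have [i|i c|k0 k0P] := accR (fun i => lead i i).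
- exact: lead_ideal.
- exact: lead_le.
have colstab d : exists n, forall m c, lead m d c -> lead n d c.
  by apply: accR => [i|i c]; [exact: lead_ideal | exact: lead_le].
have [n nP] := choice colstab.
pose K := maxn k0 (\max_(d < k0) n d).
have KP m d c : lead m d c -> lead K d c.
  have [ltd|led] := ltnP d k0 => Lc.
    apply: (lead_le (n d) K d d) => //; last exact: nP Lc.
    rewrite leq_max; apply/orP; right.
    exact: (@leq_bigmax _ (fun d : 'I_k0 => n d) (Ordinal ltd)).
  apply: (lead_le k0 K k0 d) => //; first exact: leq_maxl.
  apply: (k0P (maxn m d)); apply: lead_le Lc; [exact: leq_maxl|exact: leq_maxr].
exists K => m p Nmp.
have {Nmp}: N (maxn m K) p by apply: Nle Nmp; apply: leq_maxl.
(* Subtracting a member of N K with the same leading term lowers the degree. *)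
have [s] := ubnP (size p); elim: s p => // s IHs p; rewrite ltnS => sp Np.
case: s => [|s] in IHs sp *.
  by move: sp; rewrite leqn0 size_poly_eq0 => /eqP->; case: (Nid K).
have [q Nq [sq qs]] : lead K s p`_s by apply: (KP (maxn m K)); exists p.
rewrite -(subrK q p); apply: ideal_add => //; apply: IHs.
  rewrite ltnS; apply/leq_sizeP => j lej; rewrite coefB.
  have [<-|ne] := eqVneq s j; first by rewrite qs subrr.
  have ltj : (s < j)%N by rewrite ltn_neqAle ne.
  by rewrite !nth_default ?subrr //; apply: leq_trans ltj.
by apply: ideal_sub => //; apply: Nle Nq; apply: leq_maxr.
Qed.

(** A nonzero integer of least absolute value in the union of the chain
    generates that union. *)
Lemma noetherian_int : noetherian int.
Proof.
move=> N Nid Ninc; have Nle := chain_le Ninc.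
case: (pselect (exists n x, N n x /\ x <> 0)) => [|no]; last first.
  exists 0%N => m x Nx; have -> : x = 0.
    by apply: contrapT => x0; apply: no; exists m, x.
  by case: (Nid 0%N).
move=> [n0 [x0 [Nx0 x0nz]]].
pose P k := `[< exists n (x : int), N n x /\ `|x|%N = k.+1 >].
have exP : exists k, P k.
  exists (`|x0|%N.-1); apply/asboolP; exists n0, x0; split=> //.
  by rewrite prednK // absz_gt0; apply/eqP.
case: (ex_minnP exP) => k /asboolP[n [x [Nx xk]]] kmin.
exists n => m y Ny; have xnz : x != 0 by rewrite -absz_eq0 xk.
rewrite (divz_eq y x) -[X in N n X]addr0.
have -> : (y %% x)%Z = 0; last by rewrite addr0; apply: (Nid n).2 Nx (Nid n).1.
apply/eqP; apply: contraT => rnz.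
have Nr : N (maxn m n) (y %% x)%Z.
  have -> : (y %% x)%Z = (- (y %/ x)%Z) * x + y by rewrite /modz mulNr addrC.
  by apply: (Nid _).2;
    [apply: Nle Nx; apply: leq_maxr | apply: Nle Ny; apply: leq_maxl].
have ltr : (`|(y %% x)%Z| < `|x|)%N.
  by rewrite -ltz_nat gez0_abs ?modz_ge0 // abszE ltz_mod.
have : P (`|(y %% x)%Z|%N.-1).
  apply/asboolP; exists (maxn m n), (y %% x)%Z; split=> //.
  by rewrite prednK // absz_gt0.
move/kmin; rewrite leqNgt => /negP[]; rewrite -ltnS -xk.
by rewrite prednK // absz_gt0.
Qed.

Fixpoint span (R : comNzRingType) (V : lmodType R) (xs : seq V) (v : V) : Prop :=
  if xs is x :: xs' then exists (r : R) u, span xs' u /\ v = r *: x + u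
  else v = 0.

Lemma span_submodule (R : comNzRingType) (V : lmodType R) (xs : seq V) :
  submodule (span xs).
Proof.
elim: xs => [|x xs [s0 sS]] /=.
  by split=> // a x y -> ->; rewrite scaler0 addr0.
split; first by exists 0, 0; rewrite scale0r addr0.
move=> a _ _ [r [u [su ->]]] [s [w [sw ->]]].
exists (a * r + s), (a *: u + w); split; first exact: sS.
by rewrite scalerDr scalerA scalerDl addrACA.
Qed.

(** Induction on the number of generators: a submodule of R x + span xs is
    controlled by its intersection with span xs and by the ideal of the
    coefficients of x in its elements. *)
Lemma acc_span (R : comNzRingType) (V : lmodType R) (xs : seq V) :
  noetherian R ->
  acc (fun N : V -> Prop => submodule N /\ forall v, N v -> span xs v).
Proof.
move=> accR; elim: xs => [|x xs IHxs] N Nsub Ninc.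
  by exists 0%N => m v /(Nsub m).2 ->; case: (Nsub 0%N) => -[].
have Nle := chain_le Ninc; have spS := span_submodule xs.
pose I i r := exists2 u, span xs u & N i (r *: x + u).
have [i|i r [u su Nu]|n1 n1P] := accR I.
- have [[N0 NS] _] := Nsub i; split.
    by exists 0; [case: spS | rewrite scale0r addr0].
  move=> a r s [u su Nu] [w sw Nw]; exists (a *: u + w); first exact: spS.2.
  by rewrite scalerDl -scalerA addrACA -scalerDr; apply: NS.
- by exists u => //; apply: Ninc.
have [i|i v [Nv sv]|n2 n2P] := IHxs (fun i v => N i v /\ span xs v).
- split; last by move=> v [].
  have [[N0 NS] _] := Nsub i; split; first by split=> //; case: spS.
  by move=> a v w [Nv sv] [Nw sw]; split; [exact: NS|exact: spS.2].
- by split=> //; apply: Ninc.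
exists (maxn n1 n2) => m v Nv; have [_ /(_ v Nv) [r [u [su vE]]]] := Nsub m.
have [|u' su' Nu'] := n1P m r; first by exists u; rewrite // -vE.
have [|Nd _] := n2P (maxn n1 m) (u - u').
  split; last exact: submoduleB.
  have -> : u - u' = v - (r *: x + u') by rewrite vE opprD addrACA subrr add0r.
  by apply: submoduleB; [case: (Nsub (maxn n1 m))
    | apply: Nle Nv; apply: leq_maxr
    | apply: Nle Nu'; apply: leq_maxl].
have -> : v = (r *: x + u') + (u - u') by rewrite vE -addrA [u' + _]addrC subrK.
apply: submoduleD; first by case: (Nsub (maxn n1 n2)).
  by apply: Nle Nu'; apply: leq_maxl.
by apply: Nle Nd; apply: leq_maxr.
Qed.

Lemma acc_fg_module (R : comNzRingType) (V : lmodType R) :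
  noetherian R -> fg_module V -> acc (@submodule R V).
Proof.
move=> accR [n [s sP]] N Nsub; apply: (acc_span (xs := codom s)) => // i.
split=> // v _; have [c ->] := sP v; rewrite -big_enum /= codomE.
elim: (enum 'I_n) => [|j js IH] /=; first by rewrite big_nil.
by rewrite big_cons; exists (c j), (\sum_(i <- js) c i *: s i).
Qed.

(** * Rings generated by finitely many elements, and Zariski's lemma *)

(** The morphism A[X] -> K that extends f and maps X to u. *)
Definition ev (A K : comNzRingType) (f : {rmorphism A -> K}) (u : K) :
  {rmorphism {poly A} -> K} := horner_morph (fun a => mulrC u (f a)).

Lemma evC (A K : comNzRingType) (f : {rmorphism A -> K}) u a :
  ev f u a%:P = f a.
Proof. exact: horner_morphC. Qed.

Lemma evX (A K : comNzRingType) (f : {rmorphism A -> K}) u : ev f u 'X = u.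
Proof. exact: horner_morphX. Qed.

(** The iterated polynomial ring A[X_1]...[X_n] maps onto K when X_i is sent
    to the i-th generator. Letting the base ring vary in this way turns an
    induction on the number of generators into a change of base from A to A[X];
    f is not assumed to be injective. *)
Fixpoint generates (K : comNzRingType) (xs : seq K) (A : comNzRingType)
    (f : {rmorphism A -> K}) : Prop :=
  if xs is x :: xs' then generates xs' (ev f x) else forall y, exists a, f a = y.

(** Unlike generates, this form passes at once to quotients of K. *)
Definition generated_by (K : comNzRingType) (xs : seq K) : Prop :=
  forall P : K -> Prop, P 1 -> (forall x y, P x -> P y -> P (x - y)) ->
    (forall x y, P x -> P y -> P (x * y)) -> {in xs, forall x, P x} ->
  forall y, P y.

Lemma generated_by_generates (K : comNzRingType) (xs : seq K)
  (A : comNzRingType) (f : {rmorphism A -> K}) : generated_by xs -> generates xs f.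
Proof.
move=> Kxs.
suff: forall P : K -> Prop, (forall a, P (f a)) ->
    (forall x y, P x -> P y -> P (x - y)) ->
    (forall x y, P x -> P y -> P (x * y)) -> {in xs, forall x, P x} ->
  forall y, P y.
  elim: xs A f {Kxs} => [|x xs IH] A f hP /=.
    apply: (hP (fun y => exists a, f a = y)) => //
      [a|_ _ [a <-] [b <-]|_ _ [a <-] [b <-]].
    - by exists a.
    - by exists (a - b); rewrite rmorphB.
    - by exists (a * b); rewrite rmorphM.
  apply: IH => P Pf PB PM Pxs; apply: hP => // [a|y].
    by rewrite -(evC f x).
  by rewrite inE => /predU1P[->|/Pxs//]; rewrite -{1}(evX f x).
move=> P Pf PB PM Pxs; apply: Kxs => //.
by rewrite -(rmorph1 f).
Qed.

Lemma noetherian_generates (K : comNzRingType) (xs : seq K)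
  (A : comNzRingType) (f : {rmorphism A -> K}) :
  noetherian A -> generates xs f -> noetherian K.
Proof.
elim: xs A f => [|x xs IH] A f accA /=.
  by move=> fsurj; apply: noetherian_image accA.
by apply/IH/noetherian_poly.
Qed.

Section Integrality.
Variables (K : fieldType).

Lemma integral_trans (R S : comNzRingType) (g : {rmorphism R -> K})
    (h : {rmorphism S -> K}) y :
  (forall r, integralOver h (g r)) -> integralOver g y -> integralOver h y.
Proof.
move=> gh [p pm pr]; apply: integral_root_monic (monic_map g pm) pr _.
by apply/integral_poly => i; rewrite coef_map /=.
Qed.

Lemma integral_ev (A S : comNzRingType) (f : {rmorphism A -> K})
    (h : {rmorphism S -> K}) u :
    (forall a, integralOver h (f a)) -> integralOver h u ->
  forall p, integralOver h (ev f u p).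
Proof.
move=> fh hu p; apply: integral_horner => //.
by apply/integral_poly => i; rewrite coef_map /=.
Qed.

Lemma integral_expr (S : comNzRingType) (h : {rmorphism S -> K}) y n :
  integralOver h y -> integralOver h (y ^+ n).
Proof.
move=> hy; elim: n => [|n IH]; first exact: integral1.
by rewrite exprS; apply: integral_mul.
Qed.

(** The constant term of an equation of v, once all factors X are cancelled,
    is a multiple of v by a polynomial expression in v. *)
Lemma integral_inv_multiple (R : comNzRingType) (g : {rmorphism R -> K}) v :
    v != 0 -> integralOver g v ->
  exists2 d, g d != 0 & integralOver g (v^-1 * g d).
Proof.
move=> v0 gv; have [p pm] := gv.
have: map_poly g p != 0 by apply/monic_neq0/monic_map.
elim/poly_ind: p {pm} => [|p c IH]; first by rewrite rmorph0 eqxx.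
rewrite rmorphD rmorphM /= map_polyX map_polyC /=.
have [->|c0 _] := eqVneq (g c) 0.
  rewrite addr0 mulf_eq0 negb_or => /andP[p0 _].
  by rewrite rootM rootX (negPf v0) orbF; apply: IH.
rewrite /root !hornerE => /eqP pr; exists c => //.
have -> : g c = - ((map_poly g p).[v] * v).
  by apply/eqP; rewrite -addr_eq0 addrC pr.
rewrite mulrN mulrCA mulVf // mulr1; apply/integral_opp/integral_horner.
  by apply/integral_poly => i; rewrite coef_map; apply: integral_id.
exact: gv.
Qed.

Lemma clear_denominator (A : comNzRingType) (f : {rmorphism A -> K}) (s : A)
    (p : {poly A}) n :
  f s != 0 -> (size p <= n.+1)%N ->
  exists r, f s ^+ n * ev f (f s)^-1 p = f r.
Proof.
move=> s0; elim/poly_ind: p n => [|p c IH] n sp.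
  by exists 0; rewrite !rmorph0 mulr0.
case: n => [|n] in sp *.
  move: sp; rewrite size_MXaddC; case: ifP => [/andP[/eqP-> _] _|_].
    by exists c; rewrite mul0r add0r evC mul1r.
  rewrite ltnS leqn0 size_poly_eq0 => /eqP->.
  by exists c; rewrite mul0r add0r evC mul1r.
have [|r rE] := IH n.
  move: sp; rewrite size_MXaddC; case: ifP => [/andP[/eqP-> _] _|_ //].
  by rewrite size_poly0.
exists (r + s ^+ n.+1 * c).
rewrite !(rmorphD, rmorphM, rmorphXn) /= evC evX mulrDr -rE; congr (_ + _).
by rewrite exprSr -mulrA [f s * _]mulrCA mulfV // mulr1.
Qed.

(** Multiplying a monic equation of 1/s of degree n + 1 by s^n expresses 1/s
    as a polynomial in s. *)
Lemma integral_inv_range (A : comNzRingType) (f : {rmorphism A -> K}) s :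
  f s != 0 -> integralOver f (f s)^-1 -> exists r, f r = (f s)^-1.
Proof.
move=> s0 [p pm pr]; have p0 := monic_neq0 pm.
have [n sp] : exists n, size p = n.+2.
  have: (1 < size p)%N.
    rewrite -(size_map_poly_id0 (f := f)); last first.
      by rewrite (eqP pm) rmorph1 oner_neq0.
    by apply: root_size_gt1 pr; rewrite monic_neq0 ?monic_map.
  by case: (size p) => [|[|n]] // _; exists n.
have [|r rE] := @clear_denominator _ f s (p - 'X^(n.+1)) n s0.
  apply/leq_sizeP => j; rewrite leq_eqVlt coefB coefXn => /predU1P[<-|ltj].
    by rewrite eqxx -(eqP pm) lead_coefE sp subrr.
  by rewrite gtn_eqF // subr0 nth_default // sp.
exists (- r); rewrite rmorphN -rE rmorphB rmorphXn /= evX (eqP (pr : ev f _ p == 0)).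
by rewrite sub0r mulrN opprK exprS mulrCA exprVn mulfV ?mulr1 // expf_neq0.
Qed.

(** The ring A[1/c], seen through its image in K: the variable of A[X] is sent
    to 1/f(c). This dispenses with rings of fractions, and works when f is not
    injective. *)
Definition localize (A : comNzRingType) (f : {rmorphism A -> K}) (c : A) :
  {rmorphism {poly A} -> K} := ev f (f c)^-1.

Lemma integral_localizeM (A : comNzRingType) (f : {rmorphism A -> K}) c d y :
    f c != 0 -> f d != 0 ->
  integralOver (localize f c) y -> integralOver (localize f (c * d)) y.
Proof.
move=> c0 d0; apply: integral_trans => p; apply: integral_ev => [a|].
  by rewrite -(evC f (f (c * d))^-1); apply: integral_id.
have -> : (f c)^-1 = localize f (c * d) (d%:P * 'X).
  by rewrite rmorphM /= evC evX rmorphM /= invfM mulrCA mulfV // mulr1.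
exact: integral_id.
Qed.

(** Inverting the leading coefficient makes the equation monic. *)
Lemma algebraic_localize (A : comNzRingType) (f : {rmorphism A -> K}) p x :
    map_poly f p != 0 -> root (map_poly f p) x ->
  exists2 c, f c != 0 & integralOver (localize f c) x.
Proof.
set P := map_poly f p => P0 Px; pose c := p`_(size P).-1.
have cE : f c = lead_coef P by rewrite lead_coefE coef_map.
have c0 : f c != 0 by rewrite cE lead_coef_eq0.
exists c => //; apply: (@integral_root_monic _ _ _ _ ((f c)^-1 *: P)).
- by rewrite monicE lead_coefZ -cE mulVf.
- by rewrite rootZ ?invr_eq0.
apply/integral_poly => i; rewrite coefZ coef_map mulrC /=.
have -> : f p`_i * (f c)^-1 = localize f c ((p`_i)%:P * 'X).
  by rewrite rmorphM /= evC evX.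
exact: integral_id.
Qed.

(** Zariski's lemma. Adjoin the first generator x: by induction K is integral
    over A[x][1/v] for some v in A[x]. If x is algebraic over A, then x, and
    then a multiple of 1/v, become integral after inverting elements of A. The point
    is that x cannot be transcendental: A[x][1/v] has the field K as an
    integral extension, so it contains the inverse of 1 + x v, and 1 + X e would
    divide a power of the polynomial e expressing v, to which it is coprime. *)
Theorem zariski_lemma (xs : seq K) (A : comNzRingType) (f : {rmorphism A -> K}) :
    generates xs f ->
  exists2 a, f a != 0 & forall y, integralOver (localize f a) y.
Proof.
elim: xs A f => [|x xs IH] A f /= gen.
  exists 1 => [|y]; first by rewrite rmorph1 oner_neq0.
  have [a <-] := gen y; rewrite -(evC f (f 1)^-1); apply: integral_id.
have {IH} [a1 v0 Kint] := IH _ _ gen.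
set v := ev f x a1 in v0 Kint.
have [p p0 px] : exists2 p, map_poly f p != 0 & root (map_poly f p) x.
  apply: contrapT => trans.
  have inj0 p : ev f x p = 0 -> map_poly f p = 0.
    move=> px; apply/eqP; apply: contraT => p0; case: trans; exists p => //.
    exact/eqP.
  (* The polynomial e expresses v in terms of x. *)
  pose e := map_poly f a1.
  have e0 : e != 0.
    by apply: contra v0 => /eqP e0; rewrite /v /ev /= /horner_morph -/e e0 horner0.
  pose s := 1 + 'X * a1.
  have sE : map_poly f s = 1 + 'X * e.
    by rewrite rmorphD rmorph1 rmorphM /= map_polyX.
  have size_s : size (1 + 'X * e) = (size e).+1.
    rewrite addrC size_polyDl mulrC size_mulX // size_poly1 ltnS.
    by rewrite size_poly_gt0.
  have fs0 : ev f x s != 0.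
    apply/eqP => /inj0; rewrite sE => /(congr1 (size \o val)) /=.
    by rewrite size_s size_poly0.
  have [b bE] : exists b, localize (ev f x) a1 b = (ev f x s)^-1.
    have := @integral_inv_range _ (localize (ev f x) a1) s%:P.
    by rewrite /localize evC; apply.
  have [r rE] := clear_denominator v0 (leqnSn (size b)).
  have /inj0 : ev f x (a1 ^+ size b - s * r) = 0.
    rewrite rmorphB rmorphXn rmorphM /= -rE.
    rewrite -[ev (ev f x) _ b]/(localize (ev f x) a1 b).
    by rewrite bE mulrCA mulfV // mulr1 subrr.
  rewrite rmorphB rmorphXn rmorphM /= sE => /eqP; rewrite subr_eq0 => /eqP ek.
  have dvd : (1 + 'X * e) %| e ^+ size b by rewrite -/e ek dvdp_mulr.
  have /(coprimep_expr (size b)) : coprimep (1 + 'X * e) e.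
    apply/Bezout_coprimepP; exists (1, - 'X); rewrite /= mul1r mulNr addrK.
    exact: eqpxx.
  rewrite coprimep_def => /eqP cop.
  have := eqp_size (dvdp_gcd_idl dvd); rewrite cop size_s => -[] /esym /eqP.
  by rewrite size_poly_eq0 (negPf e0).
have {p p0 px} [c c0 cx] := algebraic_localize p0 px.
have cA a : integralOver (localize f c) (f a).
  by rewrite -(evC f (f c)^-1); apply: integral_id.
have [d d0 dv] := integral_inv_multiple v0 (integral_ev cA cx a1).
have [r rE] := clear_denominator c0 (leqnSn (size d)).
have r0 : f r != 0 by rewrite -rE mulf_neq0 ?expf_neq0.
have cr0 : f (c * r) != 0 by rewrite rmorphM mulf_neq0.
exists (c * r) => // y; apply: integral_trans (Kint y) => {y} q.
have crA a : integralOver (localize f (c * r)) (f a).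
  by rewrite -(evC f (f (c * r))^-1); apply: integral_id.
apply: integral_ev => [p|]; first exact/integral_ev/integral_localizeM.
have -> : v^-1 =
    (v^-1 * localize f c d) * (f c ^+ (size d) * f c * (f (c * r))^-1).
  rewrite [f (c * r)]rmorphM /= -rE /localize; field.
  by apply/and4P; split=> //; apply: expf_neq0.
apply: integral_mul; first exact: integral_localizeM dv.
apply: integral_mul; first by apply: integral_mul => //; apply: integral_expr.
by rewrite -[X in integralOver _ X](evX f (f (c * r))^-1); apply: integral_id.
Qed.

End Integrality.

Section FiniteFields.
Variable K : fieldType.

(** Division by a monic equation of x leaves remainders of bounded degree. *)
Lemma finite_range_ev (A : comNzRingType) (f : {rmorphism A -> K}) x :
    (exists L : seq K, forall a, f a \in L) -> integralOver f x ->
  exists L : seq K, forall p, ev f x p \in L.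
Proof.
move=> [L0 fL0] [m mm mx].
suff [L LP] : exists L : seq K,
    forall p : {poly A}, (size p < size m)%N -> ev f x p \in L.
  exists L => p; rewrite (Pdiv.RingMonic.rdivp_eq mm p) rmorphD rmorphM /=.
  rewrite [ev f x m](eqP mx) mulr0 add0r.
  exact/LP/Pdiv.Ring.ltn_rmodpN0/monic_neq0.
suff: forall n, exists L : seq K,
    forall p : {poly A}, (size p <= n)%N -> ev f x p \in L.
  by move=> /(_ (size m)) [L LP]; exists L => p /ltnW; apply: LP.
elim=> [|n [L LP]].
  exists [:: 0] => p; rewrite leqn0 size_poly_eq0 => /eqP->.
  by rewrite rmorph0 inE.
exists [seq l * x + c | l <- L, c <- L0]; elim/poly_ind => [_|p c _].
  apply/allpairsP; exists (ev f x 0, f 0); split=> //=.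
    by apply: LP; rewrite size_poly0.
  by rewrite !rmorph0 mul0r addr0.
rewrite size_MXaddC => sp; apply/allpairsP; exists (ev f x p, f c); split=> //=.
  apply: LP; move: sp; case: ifP => [/andP[/eqP-> _] _|_ //].
  by rewrite size_poly0.
by rewrite rmorphD rmorphM /= evC evX.
Qed.

Lemma finite_generates (xs : seq K) (A : comNzRingType)
    (f : {rmorphism A -> K}) :
    (exists L : seq K, forall a, f a \in L) -> (forall y, integralOver f y) ->
    generates xs f ->
  exists L : seq K, forall y, y \in L.
Proof.
elim: xs A f => [|x xs IH] A f fin fint /=.
  by have [L LP] := fin => fsurj; exists L => y; have [a <-] := fsurj y.
apply: IH => [|y]; first exact: finite_range_ev.
by apply: integral_trans (fint y) => a; rewrite -(evC f x); apply: integral_id.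
Qed.

(** Take a prime p larger than |a|. If p is nonzero in K, then 1/p is integral
    over Z[1/a] and so belongs to it: some a^k - p r vanishes in K, and this
    integer is nonzero because p does not divide a^k. *)
Lemma integral_invz_pchar (a : int) :
    a%:~R != 0 :> K ->
    (forall y, integralOver (localize (intr : {rmorphism int -> K}) a) y) ->
  exists p, p \in [pchar K].
Proof.
set f : {rmorphism int -> K} := intr => a0 Kint.
have [p ltp prp] := prime_above `|a|%N.
have [p0|p0] := eqVneq (p%:R : K) 0.
  by exists p; rewrite inE prp p0 eqxx.
have [b bE] : exists b, localize f a b = (p%:R)^-1.
  have := @integral_inv_range _ _ (localize f a) p%:R.
  by rewrite rmorph_nat; apply.
have [r rE] := clear_denominator a0 (leqnSn (size b)).
pose N := a ^+ size b - p%:R * r.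
have N0 : N%:~R = 0 :> K.
  rewrite rmorphB rmorphXn rmorphM rmorph_nat /= -[r%:~R]rE.
  rewrite -[ev f _ b]/(localize f a b) bE mulrCA mulfV // mulr1.
  by rewrite subrr.
have Nnz : N != 0.
  apply: contraTneq ltp => /eqP; rewrite subr_eq0 => /eqP aE.
  rewrite -leqNgt; apply: dvdn_leq.
    by rewrite absz_gt0; apply: contraNneq a0 => ->.
  have : (p %| `|a ^+ size b|)%N by rewrite aE abszM natz absz_nat dvdn_mulr.
  by rewrite abszX Euclid_dvdX // => /andP[].
have := @natf0_pchar K `|N|%N; apply; first by rewrite absz_gt0.
by rewrite pmulrn abszEsign rmorphM /= N0 mulr0.
Qed.

(** In characteristic p the element 1/a is a power of a, by Fermat, so K is
    integral over its finite prime field. *)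
Theorem finite_field_of_generates (xs : seq K) :
  generates xs (intr : {rmorphism int -> K}) ->
  exists L : seq K, forall y, y \in L.
Proof.
move=> gen; have [a a0 Kint] := zariski_lemma gen.
have [p charp] := integral_invz_pchar a0 Kint.
have prp := pcharf_prime charp.
apply: (finite_generates (f := intr)) gen => [|y].
  exists [seq i%:R | i <- iota 0 p] => z.
  apply/mapP; exists `|(z %% p)%Z|%N.
    rewrite mem_iota add0n -ltz_nat gez0_abs ?modz_ge0 ?ltz_pmod //.
      by rewrite ltz_nat prime_gt0.
    by rewrite gt_eqF // ltz_nat prime_gt0.
  rewrite pmulrn gez0_abs ?modz_ge0 ?gt_eqF ?ltz_nat ?prime_gt0 //.
  rewrite {1}(divz_eq z p) rmorphD rmorphM /=.
  by rewrite -[X in _ * X]pmulrn (pcharf0 charp) mulr0 add0r.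
apply: integral_trans (Kint y) => b; apply: integral_ev => [c|].
  exact: integral_id.
have -> : (intr a : K)^-1 = intr (a ^+ p.-2).
  apply: (mulfI a0); rewrite mulfV // -rmorphM -exprS.
  have p2 : p.-2.+2 = p by move: (prime_gt1 prp); case: (p) => [|[]].
  apply: (mulfI a0); rewrite mulr1 -rmorphM -exprS p2 rmorphXn.
  by rewrite -(pFrobenius_autE charp) pFrobenius_aut_int.
exact: integral_id.
Qed.

End FiniteFields.

(** * Residue fields *)

(** The last clause says that every nonzero element of the quotient is
    invertible, which is the form in which maximality is always used. *)
Definition maximal_ideal (R : comNzRingType) (I : R -> Prop) : Prop :=
  [/\ ideal I, ~ I 1 & forall x, ~ I x -> exists a, I (1 - a * x)].

(** Bundling the proof of maximality lets the field structure of the quotient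
    be inferred from the type alone. *)
Record maxideal (R : comNzRingType) := Maxideal {
  maxideal_set :> R -> Prop;
  maxidealP : maximal_ideal maxideal_set
}.

Section ResidueField.
Variables (R : comNzRingType) (m : maxideal R).

Definition maxideal_pred : {pred R} := [pred x | `[< m x >]].

Fact maxideal_pred_closed : idealr_closed maxideal_pred.
Proof.
have [[m0 mS] m1 _] := maxidealP m; split; first exact/asboolP.
  exact/asboolP.
by move=> a x y /asboolP mx /asboolP my; apply/asboolP/mS.
Qed.
HB.instance Definition _ := isIdealr.Build R maxideal_pred maxideal_pred_closed.

Definition residue : Type := Quotient.quot maxideal_pred.
HB.instance Definition _ := GRing.ComNzRing.on residue.

Local Notation pi x := (\pi_(Quotient.quot maxideal_pred) x : residue)%qT.

Lemma residue_eq0 x : pi x = 0 <-> m x.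
Proof.
rewrite -[X in _ = X]/(0 : Quotient.quot maxideal_pred).
rewrite -(rmorph0 (\pi_(Quotient.quot maxideal_pred)%qT : {rmorphism _ -> _})).
split=> [/eqP|mx]; first by rewrite -Quotient.idealrBE subr0 => /asboolP.
by apply/eqP; rewrite -Quotient.idealrBE subr0; apply/asboolP.
Qed.

Fact residue_inv_subproof (x : residue) :
  exists y : residue, (x != 0 -> y * x = 1) /\ (x = 0 -> y = 0).
Proof.
have [->|x0] := eqVneq x 0; first by exists 0; rewrite ?eqxx.
have [_ _ minv] := maxidealP m.
have [|a ma] := minv (repr x).
  by move/residue_eq0 => E; case/eqP: x0; rewrite -E reprK.
exists (pi a); split=> // [_|x00]; last by rewrite x00 eqxx in x0.
have := (residue_eq0 (1 - a * repr x)).2 ma.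
rewrite (rmorphB (\pi_(Quotient.quot maxideal_pred)%qT : {rmorphism _ -> _})).
rewrite (rmorphM (\pi_(Quotient.quot maxideal_pred)%qT : {rmorphism _ -> _})).
rewrite rmorph1 /= reprK => /eqP; rewrite subr_eq0 => /eqP E.
exact: (esym E).
Qed.

Definition residue_inv x : residue := sval (cid (residue_inv_subproof x)).

Fact residue_mulVf (x : residue) : x != 0 -> residue_inv x * x = 1.
Proof. exact: (svalP (cid (residue_inv_subproof x))).1. Qed.

Fact residue_invr0 : residue_inv 0 = 0.
Proof. exact: (svalP (cid (residue_inv_subproof 0))).2. Qed.

HB.instance Definition _ :=
  GRing.ComNzRing_isField.Build residue residue_mulVf residue_invr0.

End ResidueField.

Lemma residue_field (R : comNzRingType) (m : R -> Prop) :
    maximal_ideal m ->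
  exists (K : fieldType) (f : {rmorphism R -> K}),
    (forall y, exists x, f x = y) /\ forall x, f x = 0 <-> m x.
Proof.
move=> mm; pose M := Maxideal mm.
exists (residue M),
  (\pi_(Quotient.quot (maxideal_pred M))%qT : {rmorphism _ -> _}).
split=> [y|x]; first by exists (repr y); apply: reprK.
exact: (@residue_eq0 _ M).
Qed.

(** * Prime filtrations and contracting elements *)

(** The counterpart of prime_ideal for Prop-valued subsets. *)
Definition is_prime_ideal (R : comNzRingType) (P : R -> Prop) : Prop :=
  [/\ ideal P, ~ P 1 & forall x y, P (x * y) -> P x \/ P y].

Definition ideal_adjoin (R : comNzRingType) (I : R -> Prop) (x y : R) : Prop :=
  exists a, I (y - a * x).

Definition finite_quotient (R : comNzRingType) (I : R -> Prop) : Prop :=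
  exists L : seq R, forall y, exists2 l, l \in L & I (y - l).

Section PrimeIdeals.
Variable R : comNzRingType.
Implicit Types I J P : R -> Prop.

Lemma ideal_adjoin_ideal I x : ideal I -> ideal (ideal_adjoin I x).
Proof.
move=> Iid; split; first by exists 0; rewrite mul0r subrr; case: Iid.
move=> a y z [b Iy] [c Iz]; exists (a * b + c).
have -> : a * y + z - (a * b + c) * x = a * (y - b * x) + (z - c * x) by ring.
exact: Iid.2.
Qed.

Lemma ideal_adjoin_sub I x y : I y -> ideal_adjoin I x y.
Proof. by exists 0; rewrite mul0r subr0. Qed.

Lemma ideal_adjoin_id I x : ideal I -> ideal_adjoin I x x.
Proof. by case=> I0 _; exists 1; rewrite mul1r subrr. Qed.

Lemma maximal_is_prime I : maximal_ideal I -> is_prime_ideal I.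
Proof.
move=> [Iid I1 Iinv]; split=> // x y Ixy.
have [Ix|nIx] := pselect (I x); [by left | right].
have [a Ia] := Iinv x nIx.
have -> : y = (1 - a * x) * y + a * (x * y) by ring.
by apply: ideal_add => //; [apply: ideal_mulr | apply: ideal_mull].
Qed.

Lemma maximal_above m P :
    maximal_ideal m -> ideal P -> ~ P 1 -> (forall x, m x -> P x) ->
  maximal_ideal P.
Proof.
move=> [_ _ minv] Pid P1 mP; split=> // x nPx.
by have [|a ma] := minv x; [move/mP | exists a; apply: mP].
Qed.

Lemma exists_maximal I :
    noetherian R -> ideal I -> ~ I 1 ->
  exists2 m, maximal_ideal m & forall x, I x -> m x.
Proof.
move=> accR Iid I1.
pose F N := [/\ ideal N, ~ N 1 & forall x, I x -> N x].
have [N [] // | | m [mid m1 Im] mmax] := acc_maximal (F := F) (N0 := I) accR.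
  by split.
exists m => //; split=> // x nmx; apply: contrapT => noa; apply: nmx.
apply: (mmax (ideal_adjoin m x)); last exact: ideal_adjoin_id.
  split; first exact: ideal_adjoin_ideal.
    by case=> a ma; apply: noa; exists a.
  by move=> y /Im; apply: ideal_adjoin_sub.
by move=> y; apply: ideal_adjoin_sub.
Qed.

Lemma finite_quotient_sub I J :
  (forall x, I x -> J x) -> finite_quotient I -> finite_quotient J.
Proof.
by move=> IJ [L LP]; exists L => y; have [l lL /IJ] := LP y; exists l.
Qed.

(** An ideal N maximal among those of infinite index above I is prime: if x and
    y are not in N, then N + R x and N + R y have finite index, hence so does
    N + R x y, which therefore differs from N. *)
Lemma finite_quotient_of_primes I :
    noetherian R ->
    (forall m : R -> Prop, maximal_ideal m -> finite_quotient m) ->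
    ideal I ->
    (forall P, is_prime_ideal P -> (forall x, I x -> P x) -> maximal_ideal P) ->
  finite_quotient I.
Proof.
move=> accR finm Iid Imax; apply: contrapT => Iinf.
pose F N := [/\ ideal N, ~ finite_quotient N & forall x, I x -> N x].
have [N [] // | | N [Nid Ninf IN] Nmax] := acc_maximal (F := F) (N0 := I) accR.
  by split.
have fin_adjoin x : ~ N x -> finite_quotient (ideal_adjoin N x).
  move=> nNx; apply: contrapT => inf; apply: nNx.
  apply: (Nmax (ideal_adjoin N x)); last exact: ideal_adjoin_id.
    split=> //; first exact: ideal_adjoin_ideal.
    by move=> y /IN; apply: ideal_adjoin_sub.
  by move=> y; apply: ideal_adjoin_sub.
apply/Ninf/finm/Imax => //; split=> // [N1|x y Nxy].
  apply: Ninf; exists [:: 0] => y; exists 0; rewrite ?inE // subr0 -[y]mulr1.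
  exact: ideal_mull.
apply: contrapT => /not_orP[/fin_adjoin[L1 L1P] /fin_adjoin[L2 L2P]].
apply: Ninf; exists [seq l1 + l2 * x | l1 <- L1, l2 <- L2] => z.
have [l1 l1L [a Na]] := L1P z; have [l2 l2L [b Nb]] := L2P a.
exists (l1 + l2 * x); first by apply/allpairsP; exists (l1, l2).
have -> : z - (l1 + l2 * x) =
    z - l1 - a * x + (a - l2 - b * y) * x + b * (x * y) by ring.
by apply: ideal_add => //;
  [apply: ideal_add => //; apply: ideal_mulr | apply: ideal_mull].
Qed.

(** Since inclusions between the prime ideals to be avoided are equalities, an
    element a that avoids all of them but P can be corrected by a product of
    elements outside P, one taken from J and one from each of the other ideals. *)
Lemma prime_avoidance (J : R -> Prop) (Ps : seq (R -> Prop)) :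
    ideal J -> (forall P, List.In P Ps -> is_prime_ideal P) ->
    (forall P, List.In P Ps -> ~ maximal_ideal P -> exists2 j, J j & ~ P j) ->
    (forall P P', List.In P Ps -> List.In P' Ps ->
       ~ maximal_ideal P -> ~ maximal_ideal P' ->
       (forall x, P x -> P' x) -> forall x, P' x -> P x) ->
  exists2 a, J a & forall P, List.In P Ps -> maximal_ideal P \/ ~ P a.
Proof.
move=> Jid; elim: Ps => [|P Ps IH] /= prP JP incomp.
  by exists 0 => //; case: Jid.
have [|||a Ja aPs] := IH.
- by move=> P' inP'; apply: prP; right.
- by move=> P' inP'; apply: JP; right.
- by move=> P1 P2 in1 in2; apply: incomp; right.
have [aP|/not_orP[nmP /contrapT Pa]] := pselect (maximal_ideal P \/ ~ P a).
  by exists a => // P' [<-|/aPs].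
have [Pid P1 Ppr] := prP P (or_introl erefl).
(* A correction term outside P and inside all other nonmaximal members of Ps. *)
have [b Jb [nPb bPs]] : exists2 b, J b & ~ P b /\
    forall P', List.In P' Ps -> maximal_ideal P' \/ P' b.
  have sub P' : List.In P' Ps -> List.In P' Ps by [].
  elim: {-2}Ps sub => [|P' Qs IHQ] /= sub.
    by have [j Jj nPj] := JP P (or_introl erefl) nmP; exists j.
  have [|b Jb [nPb bQs]] := IHQ; first by move=> P2 in2; apply: sub; right.
  have inP' := sub P' (or_introl erefl).
  have [mP'|nmP'] := pselect (maximal_ideal P').
    by exists b => //; split=> // P2 [<-|/bQs//]; left.
  have [y P'y nPy] : exists2 y, P' y & ~ P y.
    apply: contrapT => noy; have := aPs P' inP'; case=> // nP'a; apply: nP'a.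
    apply: (incomp P' P) Pa => //; [by right | by left |] => x P'x.
    by apply: contrapT => nPx; apply: noy; exists x.
  have P'id : ideal P' by case: (prP P' (or_intror inP')).
  exists (b * y); first exact: ideal_mulr.
  split=> [/Ppr[]//|P2 [<-|in2]]; first by right; apply: ideal_mull.
  have [|P2b] := bQs P2 in2; [by left | right].
  by apply: ideal_mulr => //; case: (prP P2 (or_intror (sub P2 (or_intror in2)))).
exists (a + b); first exact: ideal_add.
move=> P' [<-|inP'].
  by right=> Pab; apply: nPb; rewrite -(addKr a b) addrC; apply: ideal_sub.
have [mP'|nP'a] := aPs P' inP'; first by left.
have [mP'|P'b] := bPs P' inP'; [by left | right=> P'ab; apply: nP'a].
rewrite -(addrK b a); apply: ideal_sub => //.
by case: (prP P' (or_intror inP')).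
Qed.

(** J is the intersection of one maximal ideal above each member of Ps. A prime
    ideal containing J contains one of these maximal ideals, so it is maximal. *)
Lemma ideal_in_maximal_ideals (Ps : seq (R -> Prop)) :
    noetherian R -> (forall P, List.In P Ps -> is_prime_ideal P) ->
  exists J, [/\ ideal J,
    forall a P r, J a -> List.In P Ps -> ~ P (1 - r * a)
    & forall P, is_prime_ideal P -> ~ maximal_ideal P ->
        exists2 j, J j & ~ P j].
Proof.
move=> accR; elim: Ps => [|P Ps IH] /= prP.
  exists (fun=> True); split=> // P [_ P1 _] _.
  by exists 1.
have [|J [Jid Ja JP]] := IH; first by move=> P' inP'; apply: prP; right.
have [Pid P1 _] := prP P (or_introl erefl).
have [m mmax Pm] := exists_maximal accR Pid P1.
have [mid m1 _] := mmax.
exists (fun x => J x /\ m x); split.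
- split; first by split; [case: Jid | case: mid].
  by move=> a x y [Jx mx] [Jy my]; split; [apply: Jid.2 | apply: mid.2].
- move=> a P' r [Jax max] [<-|inP']; last exact: Ja.
  move=> /Pm m1ra; apply: m1; rewrite -(subrK (r * a) 1).
  by apply: ideal_add => //; apply: ideal_mull.
- move=> P' prP' nmP'; have [P'id P'1 P'pr] := prP'.
  have [j Jj nPj] := JP P' prP' nmP'.
  have [y my nPy] : exists2 y, m y & ~ P' y.
    apply: contrapT => noy; apply: nmP'; apply: (maximal_above mmax) => // x mx.
    by apply: contrapT => nP'x; apply: noy; exists x.
  exists (j * y); last by move/P'pr => [].
  by split; [apply: ideal_mulr | apply: ideal_mull].
Qed.

End PrimeIdeals.

Section PrimeFiltrations.
Variables (R : comNzRingType) (V : lmodType R).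

(** The successive quotients are R / P: the colon ideal of the new generator x
    is P. Submodules of V are kept as subsets, so that no quotient module is
    formed. *)
Inductive prime_filtration : seq (R -> Prop) -> (V -> Prop) -> Prop :=
| PrimeFiltration0 : prime_filtration [::] (fun v => v = 0)
| PrimeFiltrationS Ps N P x :
    prime_filtration Ps N -> (forall r, P r <-> N (r *: x)) ->
    is_prime_ideal P -> prime_filtration (P :: Ps) (fun v => exists r, N (v - r *: x)).

Lemma submodule_adjoin (N : V -> Prop) x :
  submodule N -> submodule (fun v => exists r : R, N (v - r *: x)).
Proof.
move=> Nsub; split; first by exists 0; rewrite scale0r subrr; case: Nsub.
move=> a v w [r Nv] [s Nw]; exists (a * r + s).
have -> : a *: v + w - (a * r + s) *: x = a *: (v - r *: x) + (w - s *: x).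
  by rewrite scalerBr scalerDl -scalerA opprD addrACA.
exact: Nsub.2.
Qed.

Lemma prime_filtration_submodule Ps N : prime_filtration Ps N -> submodule N.
Proof.
elim=> [|{}Ps {}N P x _ Nsub _ _]; last exact: submodule_adjoin.
by split=> // a x y -> ->; rewrite scaler0 addr0.
Qed.

Lemma prime_filtration_primes Ps N P :
    prime_filtration Ps N -> List.In P Ps ->
  is_prime_ideal P /\ forall a, (forall v : V, a *: v = 0) -> P a.
Proof.
elim=> [|{}Ps {}N P' x filtN IH PN prP] //= [<-|//]; split=> // a annx.
by apply/PN; rewrite annx; case: (prime_filtration_submodule filtN).
Qed.

(** A colon ideal (N : x), maximal among those with x outside N, is prime; so a
    maximal filtered submodule is the whole of V. *)
Lemma exists_prime_filtration :
    noetherian R -> acc (@submodule R V) ->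
  exists Ps N, prime_filtration Ps N /\ forall v, N v.
Proof.
move=> accR accV; pose F N := exists Ps, prime_filtration Ps N.
have [|| N [Ps filtN] Nmax] := acc_maximal (F := F) (N0 := fun v => v = 0) accV.
- by move=> N [Ps /prime_filtration_submodule].
- by exists [::]; apply: PrimeFiltration0.
exists Ps, N; split=> //; apply: contrapT => /existsNP[x0 nNx0].
have Nsub := prime_filtration_submodule filtN.
pose colon x r := N (r *: x).
have colon_ideal x : ideal (colon x).
  split; first by rewrite /colon scale0r; case: Nsub.
  move=> a r s Nr Ns; rewrite /colon scalerDl -scalerA.
  exact: Nsub.2.
pose F' I := exists2 x, ~ N x & I = colon x.
have [||_ [x nNx ->] xmax] := acc_maximal (F := F') (N0 := colon x0) accR.
- by move=> _ [x _ ->].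
- by exists x0.
have prx : is_prime_ideal (colon x).
  split=> //; first by rewrite /colon scale1r.
  move=> a b Nab; apply: contrapT => /not_orP[na nb]; apply: na.
  apply: (xmax (colon (b *: x))); last by rewrite /colon scalerA.
    by exists (b *: x).
  move=> r; rewrite /colon scalerA mulrC -scalerA => Nr.
  exact: submoduleZ.
apply: nNx; apply: (Nmax (fun v => exists r, N (v - r *: x))).
- by exists (colon x :: Ps); apply: PrimeFiltrationS filtN _ prx.
- by move=> v Nv; exists 0; rewrite scale0r subr0.
by exists 1; rewrite scale1r subrr; case: Nsub.
Qed.

Lemma prime_filtration_finite Ps N a :
    prime_filtration Ps N ->
    (forall P : R -> Prop, List.In P Ps -> finite_quotient (ideal_adjoin P a)) ->
  exists L : seq V, forall v, N v ->
    exists2 l, l \in L & exists w, v - l = a *: w.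
Proof.
elim=> [|{}Ps {}N P x filtN IH PN prP] /= finP.
  exists [:: 0] => _ ->; exists 0; rewrite ?inE //.
  by exists 0; rewrite scaler0 subr0.
have [|L LP] := IH; first by move=> P' inP'; apply: finP; right.
have [K KP] := finP P (or_introl erefl).
exists [seq l + k *: x | l <- L, k <- K] => v [r Nv].
have [k kK [s Ps']] := KP r.
have [|l lL [w wE]] := LP (v - r *: x + (r - k - s * a) *: x).
  apply: submoduleD => //; first exact: prime_filtration_submodule filtN.
  exact/PN.
exists (l + k *: x); first by apply/allpairsP; exists (l, k).
exists (w + s *: x).
rewrite scalerDr -wE scalerA (mulrC a) !scalerBl !addrA subrK.
by rewrite [RHS]addrAC subrK opprD addrA addrAC.
Qed.

(** Multiplication by an element outside the prime ideal P is injective on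
    R / P. *)
Lemma prime_filtration_torsionfree Ps N a r v :
    prime_filtration Ps N -> (forall P, List.In P Ps -> ~ P (1 - r * a)) ->
    N v -> (1 - r * a) *: v = 0 -> v = 0.
Proof.
elim=> [|{}Ps {}N P x filtN IH PN [_ _ prP]] //= nP [s Nv] v0.
have Nsub := prime_filtration_submodule filtN.
have nP0 := nP P (or_introl erefl).
apply: IH => //; first by move=> P' inP'; apply: nP; right.
have Ns : N (s *: x).
  have : P ((1 - r * a) * s).
    apply/PN; rewrite -scalerA.
    have -> : s *: x = v - (v - s *: x) by rewrite opprB addrC subrK.
    rewrite scalerBr v0 sub0r -scaleNr.
    exact: submoduleZ.
  by move=> /prP[//|/PN].
by rewrite -(subrK (s *: x) v); apply: submoduleD.
Qed.

End PrimeFiltrations.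

Section ContractingElement.
Variables (R : comNzRingType) (V : lmodType R).
Hypothesis accR : noetherian R.
Hypothesis finR : forall m : R -> Prop, maximal_ideal m -> finite_quotient m.
Hypothesis Vfg : fg_module V.
Hypothesis dimV : forall P P' : R -> Prop,
  is_prime_ideal P -> is_prime_ideal P' ->
  (forall a, (forall v : V, a *: v = 0) -> P a) ->
  (forall x, P x -> P' x) -> ~ (forall x, P' x -> P x) -> maximal_ideal P'.

(** The element a lies in a maximal ideal above each prime of a filtration of
    V, and outside those primes that are not maximal. Its class modulo such a
    prime P cuts R / P down to dimension 0. *)
Lemma exists_contracting : exists a : R,
  (exists L : seq V, forall v, exists2 l, l \in L & exists w, v - l = a *: w) /\
  forall r (v : V), (1 - r * a) *: v = 0 -> v = 0.
Proof.
have [Ps [N [filtN NV]]] :=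
  exists_prime_filtration accR (acc_fg_module accR Vfg).
have PsP P : List.In P Ps -> _ := prime_filtration_primes filtN.
have [|J [Jid JPs JP]] := ideal_in_maximal_ideals (Ps := Ps) accR.
  by move=> P /PsP[].
have [|||a Ja aPs] := prime_avoidance (Ps := Ps) Jid.
- by move=> P /PsP[].
- by move=> P /PsP[prP _]; apply: JP.
- move=> P P' /PsP[prP annP] /PsP[prP' _] _ nmP' PP'; apply: contrapT => nP'P.
  exact/nmP'/(dimV prP prP').
exists a; split; last first.
  move=> r v; apply: prime_filtration_torsionfree filtN _ (NV v) => P.
  exact: JPs.
have [P inP|L LP] := prime_filtration_finite (a := a) filtN; last first.
  by exists L => v; apply: LP.
have [prP annP] := PsP P inP; have [Pid P1 _] := prP.
have [mP|nPa] := aPs P inP.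
  by apply: finite_quotient_sub (finR mP) => x; apply: ideal_adjoin_sub.
apply: finite_quotient_of_primes => //; first exact: ideal_adjoin_ideal.
move=> P' prP' PaP'; apply: (dimV prP prP' annP).
  by move=> x Px; apply/PaP'/ideal_adjoin_sub.
by move=> P'P; apply/nPa/P'P/PaP'/ideal_adjoin_id.
Qed.

(** Given a contracting a, let n be the rank from which the kernels of the
    powers of a on V are constant. The last clause is Krull's intersection
    theorem for the ideal generated by a: on a^n V, where a is injective, v has
    unique quotients y k by a^k, and the chain of the R (y k) stabilizes, so
    y (m + 1) = r a y (m + 1) for some m and r. *)
Lemma exists_division : exists (a : R) (n : nat),
  [/\ exists L : seq V, forall v, exists2 l, l \in L & exists w : V,
         v - l = a ^+ n.+1 *: w,
      forall v : V, a ^+ n.+1 *: v = 0 -> a ^+ n *: v = 0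
    & forall v : V, (forall k, exists w, v = a ^+ k *: w) -> v = 0].
Proof.
have accV := acc_fg_module accR Vfg.
have [a [[L LP] tf]] := exists_contracting.
have [i|i v|n nP] := accV (fun n v => a ^+ n *: v = 0).
- split=> [|c v w v0 w0]; first by rewrite scaler0.
  by rewrite scalerDr scalerA mulrC -scalerA v0 w0 scaler0 addr0.
- by rewrite exprS -scalerA => ->; rewrite scaler0.
exists a, n; split; last 1 first.
- move=> v vdiv.
  have [w wP] := choice vdiv.
  (* Indices are shifted by n to place the quotients in a^n V. *)
  pose y k := a ^+ n *: w (n + k)%N.
  have yP k : v = a ^+ k *: y k by rewrite scalerA -exprD addnC -wP.
  have inj k (u : V) : a ^+ k *: (a ^+ n *: u) = 0 -> a ^+ n *: u = 0.
    by rewrite scalerA -exprD; apply: nP.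
  have yS k : y k = a *: y k.+1.
    apply/eqP; rewrite -subr_eq0; apply/eqP.
    have E : y k - a *: y k.+1 = a ^+ n *: (w (n + k)%N - a *: w (n + k.+1)%N).
      by rewrite scalerBr !scalerA mulrC.
    rewrite E; apply: (inj k); rewrite -E scalerBr [X in _ - X]scalerA -exprSr.
    by rewrite -!yP subrr.
  have [i|i u [r ->]|m mP] := accV (fun k u => exists r, u = r *: y k).
  + split=> [|c _ _ [r ->] [s ->]]; first by exists 0; rewrite scale0r.
    by exists (c * r + s); rewrite scalerDl scalerA.
  + by exists (r * a); rewrite -scalerA -yS.
  have [|r rE] := mP m.+1 (y m.+1); first by exists 1; rewrite scale1r.
  rewrite (yP m.+1) (tf r (y m.+1)) ?scaler0 //.
  by rewrite scalerBl scale1r -scalerA -yS -rE subrr.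
- elim: n.+1 => [|k [K KP]].
    exists [:: 0] => v; exists 0; rewrite ?inE //.
    by exists v; rewrite subr0 scale1r.
  exists [seq l + a *: l' | l <- L, l' <- K] => v.
  have [l lL [w wE]] := LP v; have [l' l'K [u uE]] := KP w.
  exists (l + a *: l'); first by apply/allpairsP; exists (l, l').
  by exists u; rewrite opprD addrA wE -scalerBr uE scalerA -exprS.
- by move=> v; apply: nP.
Qed.

End ContractingElement.

(** * The group ring, and Krull dimension one *)

Section GeneratedRings.
Variables (R : comNzRingType) (xs : seq R).
Hypothesis Rxs : generated_by xs.

Lemma noetherian_generated : noetherian R.
Proof.
apply: (@noetherian_generates _ xs _ (intr : {rmorphism int -> R})).
  exact: noetherian_int.
exact: generated_by_generates.
Qed.

Lemma finite_residue (m : R -> Prop) : maximal_ideal m -> finite_quotient m.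
Proof.
move=> /residue_field[K [f [fsurj fker]]].
have [L LP] : exists L : seq K, forall y, y \in L.
  apply: (@finite_field_of_generates _ (map f xs)).
  apply: generated_by_generates => P P1 PB PM Pxs y; have [x <-] := fsurj y.
  move: x; apply: Rxs => [|x y' Px Py|x y' Px Py|x xin].
  - by rewrite rmorph1.
  - by rewrite rmorphB; apply: PB.
  - by rewrite rmorphM; apply: PM.
  - by apply: Pxs; apply: map_f.
have [g gP] := choice fsurj.
exists (map g L) => x; exists (g (f x)); first exact: map_f.
by apply/fker; rewrite rmorphB gP subrr.
Qed.

End GeneratedRings.

Lemma groupring_generated (Q : zmodType) :
  fg_group Q -> exists xs : seq (groupring Q), generated_by xs.
Proof.
move=> [n [s sP]].
exists (codom (fun i => gr (s i)) ++ codom (fun i => gr (- s i))).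
move=> P P1 PB PM Pxs.
have P0 : P 0 by rewrite -(subrr 1); apply: PB.
have PN x : P x -> P (- x) by move=> Px; rewrite -sub0r; apply: PB.
have PD x y : P x -> P y -> P (x + y).
  by move=> Px Py; rewrite -[y]opprK; apply: PB => //; apply: PN.
have Psi i : P (gr (s i)) by apply: Pxs; rewrite mem_cat codom_f.
have PNsi i : P (gr (- s i)) by apply: Pxs; rewrite mem_cat codom_f orbT.
have Pmul p q : P (gr p) -> P (gr q) -> P (gr (p + q)).
  by move=> Pp Pq; rewrite grD; apply: PM.
have Pnat p k : P (gr p) -> P (gr (p *+ k)).
  move=> Pp; elim: k => [|k IH]; first by rewrite mulr0n gr0.
  by rewrite mulrS; apply: Pmul.
have Pgr q : P (gr q).
  have [c ->] := sP q.
  elim/big_ind: _ => [||i _]; [by rewrite gr0 | exact: Pmul |].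
  by case: (c i) => k; rewrite ?NegzE ?mulrNz -?mulNrz -pmulrn; apply: Pnat.
have PU (c : int) q : P (<< c *g q >> : {malg int[Q]}).
  have Unat k : P (<< k%:Z *g q >> : {malg int[Q]}).
    elim: k => [|k IH]; first by rewrite monalgU0.
    rewrite intS monalgUD; apply: PD IH.
    exact: Pgr.
  case: c => k; first exact: Unat.
  by rewrite NegzE monalgUN; apply: PN.
move=> g; rewrite (monalgE (g : {malg int[Q]})).
by elim/big_ind: _ => //.
Qed.

(** Otherwise a maximal ideal above P' completes a chain of three prime ideals,
    which all contain the annihilator of V and thus descend to the quotient. *)
Lemma krull_dim1_maximal (R : comNzRingType) (V : lmodType R)
    (P P' : R -> Prop) :
    noetherian R -> module_has_krull_dim V 1 ->
    is_prime_ideal P -> is_prime_ideal P' ->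
    (forall a, (forall v : V, a *: v = 0) -> P a) ->
    (forall x, P x -> P' x) -> ~ (forall x, P' x -> P x) ->
  maximal_ideal P'.
Proof.
move=> accR [_ dim1] prP prP' annP PP' nP'P; apply: contrapT => nmax.
have [P'id P'1 _] := prP'.
have [m mmax P'm] := exists_maximal accR P'id P'1.
have nmP' : ~ (forall x, m x -> P' x).
  by move=> mP'; apply/nmax/(maximal_above mmax).
pose C i : R -> Prop := if i is i'.+1 then if i' is 0%N then P' else m else P.
have Cpr i : is_prime_ideal (C i).
  by case: i => [|[|i]] //; apply: maximal_is_prime.
have Cann i a : (forall v : V, a *: v = 0) -> C i a.
  by move=> ann; case: i => [|[|i]] /=; [|apply: PP'|apply/P'm/PP']; apply: annP.
pose D i : {pred ann_quot V} := [pred x | `[< C i (repr x) >]].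
pose pi a : ann_quot V := (\pi_(Quotient.quot (annihilator V)) a)%qT.
have piP i a : pi a \in D i <-> C i a.
  have [Cid _ _] := Cpr i.
  have ca : C i (repr (pi a) - a).
    by apply/Cann/annihilatorP/annq_pi_eq; rewrite reprK.
  split=> [/asboolP Ca|Ca].
    have -> : a = repr (pi a) - (repr (pi a) - a) by rewrite opprB addrC subrK.
    exact: ideal_sub.
  apply/asboolP; rewrite -(subrK a (repr (pi a))).
  exact: ideal_add.
have pi0 : pi 0 = 0.
  by apply: (addrI (pi 0)); rewrite annq_pi_add !addr0.
have surj x : x = pi (repr x) by rewrite /pi reprK.
have D2 : prime_chain (ann_quot V) 2.
  exists D; split=> [i _|i lti].
    have [[C0 CS] C1 CM] := Cpr i; split.
    - by rewrite -pi0; apply/piP.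
    - by apply/negP => /(piP i 1).
    - move=> a x y; rewrite (surj a) (surj x) (surj y) => /piP Cx /piP Cy.
      rewrite [_ * _]annq_pi_mul annq_pi_add.
      by apply/piP/CS.
    - move=> x y; rewrite (surj x) (surj y) [_ * _]annq_pi_mul => /piP /CM[] Cx.
        by apply/orP; left; apply/piP.
      by apply/orP; right; apply/piP.
  have sub j : (forall x, C j x -> C j.+1 x) -> {subset D j <= D j.+1}.
    by move=> CC x; rewrite (surj x) => /piP /CC /piP.
  have nsub j : ~ (forall x, C j.+1 x -> C j x) -> ~ {subset D j.+1 <= D j}.
    by move=> nC DD; apply: nC => x /piP /DD /piP.
  by case: i lti => [|[|//]] _; split; (apply: sub || apply: nsub).
by have := dim1 _ D2.
Qed.

(** * Self-similar actions from virtual endomorphisms *)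

Section VirtualEndomorphism.
Variables (G : groupType) (H : G -> Prop) (f : G -> G).
Variables (k : nat) (t : 'I_k -> G).
Hypothesis H1 : H 1%g.
Hypothesis HM : forall x y, H x -> H y -> H (x * y)%g.
Hypothesis HV : forall x, H x -> H x^-1%g.
Hypothesis fM : forall x y, H x -> H y -> f (x * y)%g = (f x * f y)%g.
Hypothesis t_cover : forall g, exists i, H (g * (t i)^-1)%g.
Hypothesis t_inj : forall i j, H (t i * (t j)^-1)%g -> i = j.

Definition coset_index g : 'I_k := sval (cid (t_cover g)).
Definition coset_act g i := coset_index (t i * g).
(** The Schreier cocycle: t_i g = coset_state g i * t_j, where j is the image
    of i. *)
Definition coset_state g i := (t i * g * (t (coset_act g i))^-1)%g.

Lemma coset_indexP g : H (g * (t (coset_index g))^-1)%g.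
Proof. exact: svalP (cid (t_cover g)). Qed.

Lemma coset_stateH g i : H (coset_state g i).
Proof. exact: coset_indexP. Qed.

Lemma coset_index_uniq g i : H (g * (t i)^-1)%g -> coset_index g = i.
Proof.
move=> Hg; apply: t_inj.
have := HM (HV (coset_indexP g)) Hg.
by rewrite invgM invgK mulgA mulgVK.
Qed.

Lemma coset_actM g h i : coset_act (g * h)%g i = coset_act h (coset_act g i).
Proof.
apply: coset_index_uniq.
have := HM (coset_stateH g i) (coset_stateH h (coset_act g i)).
by rewrite /coset_state !mulgA mulgVK.
Qed.

Lemma coset_stateM g h i :
  coset_state (g * h)%g i = (coset_state g i * coset_state h (coset_act g i))%g.
Proof. by rewrite /coset_state coset_actM !mulgA mulgVK. Qed.

Lemma virtual1 : f 1%g = 1%g.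
Proof. by apply: (mulgI (f 1%g)); rewrite -fM // !mulg1. Qed.

Lemma virtualV x : H x -> f x^-1%g = (f x)^-1%g.
Proof.
by move=> Hx; apply: (mulgI (f x)); rewrite -fM ?mulgV ?virtual1 //; apply: HV.
Qed.

(** The state of g at the vertex i is the image by f of its cocycle at i. *)
Fixpoint coset_tree g (v : vertex k) : vertex k :=
  if v is i :: w then coset_act g i :: coset_tree (f (coset_state g i)) w
  else [::].

Lemma coset_treeM g h v :
  coset_tree (g * h)%g v = coset_tree h (coset_tree g v).
Proof.
elim: v g h => //= i w IH g h.
by rewrite coset_actM coset_stateM fM ?IH //; apply: coset_stateH.
Qed.

Lemma coset_act1 i : coset_act 1%g i = i.
Proof. by apply: coset_index_uniq; rewrite mulg1 mulgV. Qed.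

Lemma coset_tree1 v : coset_tree 1%g v = v.
Proof.
elim: v => //= i w IH.
by rewrite /coset_state coset_act1 mulg1 mulgV virtual1 IH.
Qed.

Lemma size_coset_tree g v : size (coset_tree g v) = size v.
Proof. by elim: v g => //= i w IH g; rewrite IH. Qed.

Lemma coset_tree_rcons g v i :
  exists j, coset_tree g (rcons v i) = rcons (coset_tree g v) j.
Proof.
elim: v g => [|a w IH] g /=; first by exists (coset_act g i).
by have [j ->] := IH (f (coset_state g a)); exists j.
Qed.

Fact coset_tree_aut g : is_tree_aut (coset_tree g).
Proof.
have K x : cancel (coset_tree x) (coset_tree x^-1%g).
  by move=> v; rewrite -coset_treeM mulgV coset_tree1.
have K' x : cancel (coset_tree x^-1%g) (coset_tree x).
  by move=> v; rewrite -coset_treeM mulVg coset_tree1.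
have desc x v w : descendant v w -> descendant (coset_tree x v) (coset_tree x w).
  by move=> [i ->]; apply: coset_tree_rcons.
split=> [|v|v w].
- by exists (coset_tree g^-1%g).
- exact: size_coset_tree.
by split=> [|/(desc g^-1%g)]; [apply: desc | rewrite !K].
Qed.

Definition coset_rep g : treeAut k := mk_treeAut (coset_tree_aut g).

Hypothesis f_simple : forall K : G -> Prop,
  K 1%g -> (forall x y, K x -> K y -> K (x * y)%g) ->
  (forall x, K x -> K x^-1%g) -> (forall x g, K x -> K (x ^ g)%g) ->
  (forall x, K x -> H x) -> (forall x, K x -> K (f x)) ->
  forall x, K x -> x = 1%g.

(** The kernel is normal. It lies in H because it fixes the coset H, and it is
    f-invariant because the state at that coset is conjugate to the image by
    f. *)
Lemma coset_tree_faithful g : (forall v, coset_tree g v = v) -> g = 1%g.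
Proof.
move: g; apply: f_simple => [v|x y Kx Ky v|x Kx v|x g Kx v|x Kx|x Kx].
- exact: coset_tree1.
- by rewrite coset_treeM Kx Ky.
- by rewrite -[in LHS](Kx v) -coset_treeM mulgV coset_tree1.
- by rewrite /conjg !coset_treeM Kx -coset_treeM mulVg coset_tree1.
- have Ht : H (t (coset_index 1%g)).
    by rewrite -[t _]invgK -[(t _)^-1%g]mul1g; apply/HV/coset_indexP.
  have := coset_stateH x (coset_index 1%g).
  have [E] := Kx [:: coset_index 1%g]; rewrite /coset_state E => Hx.
  have := HM (HM (HV Ht) Hx) Ht.
  by rewrite !mulgA mulVg mul1g mulgVK.
- move=> v; set i := coset_index 1%g.
  have Ht : H (t i).
    by rewrite -[t _]invgK -[(t _)^-1%g]mul1g; apply/HV/coset_indexP.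
  have Ki w : coset_tree (f (coset_state x i)) w = w.
    by have [_] := Kx (i :: w).
  have [Ei] := Kx [:: i].
  have Hx : H x.
    have := HM (HM (HV Ht) (coset_stateH x i)) Ht.
    by rewrite /coset_state Ei !mulgA mulVg mul1g mulgVK.
  have -> : f x = ((f (t i))^-1 * f (coset_state x i) * f (t i))%g.
    rewrite /coset_state Ei !fM ?virtualV //; [|exact: HM|exact: HV].
    by rewrite !mulgA mulVg mul1g mulgVK.
  by rewrite !coset_treeM Ki -coset_treeM mulVg coset_tree1.
Qed.

Theorem self_similar_of_transversal : transitive_self_similar G.
Proof.
exists k, (fun a => `[< exists x, coset_rep x = a >]).
have repM x y : coset_rep (x * y)%g = (coset_rep x * coset_rep y)%g.
  by apply: treeAut_eq => v; apply: coset_treeM.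
have rep1 : coset_rep 1%g = 1%g by apply: treeAut_eq; apply: coset_tree1.
have repV x : coset_rep x^-1%g = (coset_rep x)^-1%g.
  by apply: (mulgI (coset_rep x)); rewrite -repM !mulgV.
split.
- by have [i _] := t_cover 1%g; apply: leq_ltn_trans (ltn_ord i).
- split; first by apply/asboolP; exists 1%g.
  move=> _ _ /asboolP[x <-] /asboolP[y <-]; apply/asboolP.
  by exists (x * y^-1)%g; rewrite repM repV.
- move=> _ /asboolP[x <-] i; apply/asboolP; exists (f (coset_state x i)).
  exact: treeAut_eq.
- move=> i j; exists (coset_rep ((t i)^-1 * t j)%g).
    by apply/asboolP; exists ((t i)^-1 * t j)%g.
  rewrite /= /coset_act; congr [:: _]; apply: coset_index_uniq.
  by rewrite mulgA mulgV mul1g mulgV.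
exists coset_rep; split=> // [x y E|a]; last first.
  by split=> [/asboolP|?]; [|apply/asboolP].
apply: (mulIg y^-1%g); rewrite mulgV; apply: coset_tree_faithful => v.
rewrite coset_treeM -[coset_tree x v]/(coset_rep x v) E /= -coset_treeM.
by rewrite mulgV coset_tree1.
Qed.

End VirtualEndomorphism.

Lemma exists_transversal (G : groupType) (H : G -> Prop) (L : seq G) :
    H 1%g -> (forall x y, H x -> H y -> H (x * y)%g) ->
    (forall x, H x -> H x^-1%g) ->
    (forall g, exists2 l, l \in L & H (g * l^-1)%g) ->
  exists (k : nat) (t : 'I_k -> G),
    (forall g, exists i, H (g * (t i)^-1)%g) /\
    (forall i j, H (t i * (t j)^-1)%g -> i = j).
Proof.
move=> H1 HM HV LP.
pose rep g := nth 1%g L (find (fun l => `[< H (g * l^-1)%g >]) L).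
have has_rep g : has (fun l => `[< H (g * l^-1)%g >]) L.
  by have [l lL Hl] := LP g; apply/hasP; exists l => //; apply/asboolP.
have repH g : H (g * (rep g)^-1)%g by apply/asboolP/(nth_find 1%g (has_rep g)).
have repL g : rep g \in L by rewrite mem_nth // -has_find.
have rep_eq x y : H (x * y^-1)%g -> rep x = rep y.
  move=> Hxy; rewrite /rep; congr (nth _ _ _); apply: eq_find => l /=.
  apply/asboolP/asboolP => Hl.
    by have := HM _ _ (HV _ Hxy) Hl; rewrite invgM invgK mulgA mulgVK.
  by have := HM _ _ Hxy Hl; rewrite mulgA mulgVK.
pose T := undup (map rep L).
have repT g : rep g \in T.
  by rewrite mem_undup (rep_eq g (rep g)) // map_f.
exists (size T), (fun i => nth 1%g T i); split=> [g|i j Hij].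
  have ltT : (index (rep g) T < size T)%N by rewrite index_mem.
  by exists (Ordinal ltT); rewrite nth_index.
have repK x : x \in T -> rep x = x.
  by rewrite mem_undup => /mapP[y _ ->]; rewrite -(rep_eq y (rep y)).
apply/val_inj/eqP; rewrite -(nth_uniq 1%g (ltn_ord i) (ltn_ord j) (undup_uniq _)).
apply/eqP; rewrite -(repK _ (mem_nth 1%g (ltn_ord i))).
by rewrite -(repK _ (mem_nth 1%g (ltn_ord j))); apply: rep_eq.
Qed.

(** As L meets every coset of H, the index of H is finite. *)
Theorem self_similar_of_virtual_endomorphism (G : groupType)
    (H : G -> Prop) (f : G -> G) (L : seq G) :
    H 1%g -> (forall x y, H x -> H y -> H (x * y)%g) ->
    (forall x, H x -> H x^-1%g) ->
    (forall g, exists2 l, l \in L & H (g * l^-1)%g) ->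
    (forall x y, H x -> H y -> f (x * y)%g = (f x * f y)%g) ->
    (forall K : G -> Prop,
      K 1%g -> (forall x y, K x -> K y -> K (x * y)%g) ->
      (forall x, K x -> K x^-1%g) -> (forall x g, K x -> K (x ^ g)%g) ->
      (forall x, K x -> H x) -> (forall x, K x -> K (f x)) ->
      forall x, K x -> x = 1%g) ->
  transitive_self_similar G.
Proof.
move=> H1 HM HV LP fM simple.
have [k [t [tc ti]]] := exists_transversal H1 HM HV LP.
exact: self_similar_of_transversal H1 HM HV fM tc ti simple.
Qed.

(** * Split metabelian groups *)

(** Put M = a^n B. The subgroup is H = aM >| Q, and f divides by a in the first
    component; a is injective on M, whence a well defined morphism. An
    f-invariant subgroup of H meets B in elements that are divisible by a as
    often as desired. *)
Lemma sdprod_self_similar (Q : zmodType) (B : lmodType (groupring Q))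
    (a : groupring Q) (n : nat) :
    centralizer B =i pred1 0 ->
    (exists L : seq B, forall v, exists2 l, l \in L &
       exists w, v - l = a ^+ n.+1 *: w) ->
    (forall v : B, a ^+ n.+1 *: v = 0 -> a ^+ n *: v = 0) ->
    (forall v : B, (forall k, exists w, v = a ^+ k *: w) -> v = 0) ->
  transitive_self_similar (sdprod B).
Proof.
move=> CQB [L LP] inj cap.
have quot (b : B) : exists c : B, (exists v, b = a ^+ n.+1 *: v) ->
    b = a *: c /\ exists w, c = a ^+ n *: w.
  have [[v ->]|nob] := pselect (exists v, b = a ^+ n.+1 *: v).
    by exists (a ^+ n *: v) => _; rewrite exprS scalerA; split=> //; exists v.
  by exists 0.
have [d dP] := choice quot.
have d_uniq b v : b = a ^+ n.+1 *: v -> d b = a ^+ n *: v.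
  move=> bE; have [|bd [w dE]] := dP b; first by exists v.
  apply/eqP; rewrite dE -subr_eq0 -scalerBr; apply/eqP/inj.
  by rewrite scalerBr -bE exprS -scalerA -dE -bd subrr.
pose H (x : sdprod B) := exists v, x.1 = a ^+ n.+1 *: v.
pose f (x : sdprod B) : sdprod B := (d x.1, x.2).
apply: (@self_similar_of_virtual_endomorphism _ H f [seq (l, 0) | l <- L]).
- by exists 0; rewrite scaler0.
- move=> x y [v xv] [w yw]; exists (gr y.2 *: v + w).
  by rewrite /= xv yw scalerDr !scalerA mulrC.
- move=> x [v xv]; exists (- (gr (- x.2) *: v)).
  by rewrite /= xv scalerN !scalerA mulrC.
- move=> [b q]; have [l lL [w wE]] := LP b.
  exists (l, 0); first exact: map_f.
  exists w; rewrite -wE /= /sdprod_mul /= oppr0 gr0 !scale1r //.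
- move=> x y [v xv] [w yw]; congr pair.
  rewrite /= (d_uniq _ _ xv) (d_uniq _ _ yw).
  rewrite (d_uniq _ (gr y.2 *: v + w)); first by rewrite scalerDr !scalerA mulrC.
  by rewrite xv yw scalerDr !scalerA mulrC.
move=> K K1 KM KV KJ KH Kf.
have KB (b : B) : K (b, 0) -> b = 0.
  move=> Kb; apply: cap => k; elim: k b Kb => [|k IH] b Kb.
    by exists b; rewrite scale1r.
  have [v bv] := KH _ Kb; have [w dw] := IH _ (Kf _ Kb).
  have [|bd _] := dP b; first by exists v.
  by exists w; rewrite exprS -scalerA -dw.
case=> b q Kbq.
have q0 : q = 0.
  apply/eqP; suff: q \in pred1 (0 : Q) by [].
  rewrite -CQB; apply/asboolP => c.
  (* The commutator of an element of K with c in B lies in the intersection of K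
     with B, which is trivial. *)
  have := KM _ _ (KV _ Kbq) (KJ _ ((c, 0) : sdprod B) Kbq).
  have -> : (((b, q) : sdprod B)^-1 * ((b, q) : sdprod B) ^ ((c, 0) : sdprod B))%g
      = (- ((gr q - 1) *: c), 0) :> sdprod B.
    rewrite /conjg; congr pair; rewrite /= ?oppr0 ?add0r ?addr0 ?addNr //.
    rewrite gr0 !scale1r scalerN scalerA -grD subrr gr0 scale1r.
    rewrite scalerN scalerBl scale1r.
    by rewrite opprB addrCA addKr addrC.
  by move/KB/eqP; rewrite oppr_eq0 => /eqP.
by rewrite q0 in Kbq *; rewrite (KB _ Kbq).
Qed.

Theorem theoremC (Q : zmodType) (B : lmodType (groupring Q))
  (Qfg : fg_group Q) (Bfg : fg_module B)
  (Bdim : module_has_krull_dim B 1)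
  (CQB : centralizer B =i pred1 0%R) :
  transitive_self_similar (sdprod B).
Proof.
have [xs ZQxs] := groupring_generated Qfg.
have accZQ := noetherian_generated ZQxs.
have [|a [n [fin inj cap]]] := exists_division accZQ (finite_residue ZQxs) Bfg.
  by move=> P P'; apply: krull_dim1_maximal Bdim.
exact: (sdprod_self_similar CQB fin inj cap).
Qed.
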